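(* For every real number $\alpha>1$, $\frac{s}{\alpha}-d_T(\alpha,s)=\Theta_\alpha(\sqrt{s})$ as $s\to\infty$. That is, for every real $\alpha>1$ there exist constants $c_\alpha,C_\alpha>0$ and $s_0(\alpha)$, depending only on $\alpha$, such that for every integer $s\ge s_0(\alpha)$, $$c_\alpha\sqrt{s}\le \frac{s}{\alpha}-d_T(\alpha,s)\le C_\alpha\sqrt{s}.$$
   Context: A tournament is a digraph obtained by orienting each edge of a finite complete graph in exactly one direction. The minimum out-degree $\delta^+(D)$ of a digraph $D$ is the minimum over its vertices of the number of out-neighbours. A subtournament of a tournament $T$ on $n$ vertices is the tournament $T[X]$ induced by a set $X$ of $n$ vertices. For a real number $\alpha>1$ and a positive integer $s$, $d_T(\alpha,s)$ denotes the largest integer $d$ such that, for every positive integer $n$, every tournament on $\lfloor\alpha n\rfloor$ vertices with minimum out-degree at least $s$ contains a subtournament on $n$ vertices with minimum out-degree at least $d$. (The subscript $T$ in $d_T$ stands for ''tournament''; it is not a variable.) *)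

(* Defs.v *)
From mathcomp Require Import all_boot all_order all_algebra.
From mathcomp Require Import boolp classical_sets reals.

Set Implicit Arguments.
Unset Strict Implicit.
Unset Printing Implicit Defensive.

Import Order.TTheory GRing.Theory Num.Theory.

(* [e x y] means that the edge between x and y is oriented from x to y. *)
Definition tournament (V : finType) (e : rel V) : Prop :=
  irreflexive e /\ forall x y : V, x != y -> e x y (+) e y x.

Definition outdeg (V : finType) (e : rel V) (v : V) : nat :=
  #|[set w | e v w]|.

(* The default value #|V| never interferes when V is nonempty, since every
   out-degree is at most #|V|: see [leq_min_outdeg]. *)
Definition min_outdeg (V : finType) (e : rel V) : nat :=
  \big[minn/#|V|]_(v : V) outdeg e v.

Definition induced (V : finType) (e : rel V) (X : {set V}) :
    rel {x : V | x \in X} :=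
  fun u v => e (val u) (val v).
Arguments induced {V} e X u v.

(* The number of vertices is the integer part of alpha * n, which for
   alpha * n >= 0 is [Num.truncn (alpha * n%:R)]. *)
Definition forces (R : realType) (alpha : R) (s d : nat) : Prop :=
  forall n : nat, (0 < n)%N ->
  forall (V : finType) (e : rel V),
    tournament e ->
    #|V| = Num.truncn (alpha * n%:R)%R ->
    (s <= min_outdeg e)%N ->
  exists X : {set V}, #|X| = n /\ (d <= min_outdeg (induced e X))%N.

(* Largest among the integers is the same as largest among the naturals: d = 0
   is always forced when alpha > 1. *)
Definition largest_forced (R : realType) (alpha : R) (s d : nat) : Prop :=
  forces alpha s d /\ forall d' : nat, forces alpha s d' -> (d' <= d)%N.

(* The default value 0 is not used when alpha > 1: see [dTP]. *)
Definition dT (R : realType) (alpha : R) (s : nat) : nat :=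
  xget 0%N (largest_forced alpha s).

Lemma leq_min_outdeg (V : finType) (e : rel V) (d : nat) : (0 < #|V|)%N ->
  (d <= min_outdeg e)%N = [forall v, d <= outdeg e v]%N.
Proof.
move=> /card_gt0P[v0 _]; apply/idP/forallP => [h v|h].
  apply: leq_trans h _; rewrite /min_outdeg.
  have := mem_index_enum v; elim: (index_enum V) => // w r IH.
  rewrite in_cons big_cons geq_min => /orP[/eqP ->|/IH ->]; first by rewrite leqnn.
  by rewrite orbT.
apply: (big_ind (fun x => d <= x)%N) => [|x y hx hy|v _]; last exact: h.
  exact: leq_trans (h v0) (max_card _).
by rewrite leq_min hx.
Qed.

Lemma min_outdeg_le_card (V : finType) (e : rel V) :
  (min_outdeg e <= #|V|)%N.
Proof.
by apply: (big_ind (fun x => x <= #|V|)%N) => // [x y hx _|v _]; rewrite ?geq_min ?hx // max_card.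
Qed.

Definition parity_tournament (m : nat) : rel 'I_m :=
  fun i j => if (i < j)%N then odd (j - i) else (j < i)%N && ~~ odd (i - j).

Lemma parity_tournamentP (m : nat) : tournament (@parity_tournament m).
Proof.
split=> [i|i j]; rewrite /parity_tournament ?ltnn // -(inj_eq val_inj) /=.
by case: ltngtP => //= _ _; case: odd.
Qed.

Lemma parity_tournament_outdeg (m s : nat) : (4 * s < m)%N ->
  (s <= min_outdeg (@parity_tournament m))%N.
Proof.
move=> hm; have m0 : (0 < m)%N by exact: leq_trans hm.
rewrite leq_min_outdeg ?card_ord //; apply/forallP => i.
pose f (k : 'I_s) : nat := if (2 * s <= i)%N then i - k.+1.*2 else i + k.*2.+1.
have kle (k : 'I_s) : (k.+1.*2 <= 2 * s)%N by rewrite mul2n leq_double.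
have fm k : (f k < m)%N.
  rewrite /f; case: (leqP (2 * s) i) => [_|h].
    exact: leq_ltn_trans (leq_subr _ _) (ltn_ord i).
  apply: leq_ltn_trans hm; rewrite (_ : 4 = 2 + 2)%N // mulnDl leq_add //.
    exact: ltnW.
  by apply: leq_trans (kle k); rewrite doubleS.
pose g k := Ordinal (fm k).
have g_inj : injective g.
  move=> k l /(congr1 val) /=; rewrite /f; case: (leqP (2 * s) i) => h E; apply: val_inj.
    have := congr1 (subn i) E.
    rewrite !subKn ?(leq_trans (kle _) h) // => /double_inj [] //.
  by move/eqP: E; rewrite eqn_add2l => /eqP [] /double_inj.
rewrite -{1}(card_ord s) -(card_codom g_inj); apply: subset_leq_card.
apply/fintype.subsetP => _ /codomP[k ->]; rewrite finset.inE /parity_tournament /= /f.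
case: (leqP (2 * s) i) => h; last first.
  by rewrite -{1}[nat_of_ord i]addn0 ltn_add2l /= addKn /= odd_double.
have hk := leq_trans (kle k) h.
rewrite ltnNge leq_subr /= subKn // odd_double andbT.
by rewrite ltn_subrL doubleS (leq_trans _ hk).
Qed.

Lemma forces0 (R : realType) (alpha : R) (s : nat) :
  (1 < alpha)%R -> forces alpha s 0.
Proof.
move=> a1 n n0 V e _ cV _.
have nV : (n <= #|V|)%N.
  by rewrite cV truncn_ge_nat ?mulr_ge0 ?ler_peMl ?ler0n ?ltW // (lt_trans _ a1).
by exists [set x in take n (enum V)]; split=> //;
  rewrite cardsE (card_uniqP _) ?take_uniq ?enum_uniq // size_takel // -cardE.
Qed.

Lemma dTP (R : realType) (alpha : R) (s : nat) :
  (1 < alpha)%R -> largest_forced alpha s (dT alpha s).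
Proof.
move=> a1; apply: (@xgetPex _ 0%N (largest_forced alpha s)).
pose n := (4 * s).+1; pose m := Num.truncn (alpha * n%:R)%R.
have nm : (n <= m)%N.
  by rewrite truncn_ge_nat ?mulr_ge0 ?ler_peMl ?ler0n ?ltW // (lt_trans _ a1).
have bnd d : forces alpha s d -> (d <= n)%N.
  move=> /(_ n isT _ _ (parity_tournamentP m) (card_ord _)).
  move=> /(_ (parity_tournament_outdeg nm)) [X [cX /leq_trans]]; apply.
  by apply: leq_trans (min_outdeg_le_card _) _; rewrite card_sig cX.
have ex : exists d, `[< forces alpha s d >].
  by exists 0%N; apply/asboolP; exact: forces0.
have ub d : `[< forces alpha s d >] -> (d <= n)%N by move/asboolP/bnd.
case: (ex_maxnP ex ub) => d /asboolP hd dmax; exists d; split=> // d' hd'.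
by apply: dmax; apply/asboolP.
Qed.

(* Main.v *)
Require Import Defs.
From mathcomp Require Import all_boot all_order all_algebra all_fingroup cyclic.
From mathcomp Require Import reals sequences exp.
From mathcomp Require Import ring lra zify.

(** Two independent arguments give the two inequalities.

    Upper bound on s / alpha - d_T.  In a tournament on m vertices, at most
    2 D + 1 vertices have out-degree at most D, since the average out-degree
    inside a set of k vertices is (k - 1) / 2.  For any family of sets with this
    sparsity, a Spencer-type discrepancy argument rounds the constant weight
    p = n / m on the vertices to a set X of exactly n vertices which meets each
    member S of the family in at least p |S| - O(sqrt |S|) points
    ([sparse_rounding]).  Applied to the out-neighbourhoods this loses only
    O(sqrt s) against s / alpha, because p >= 1 / alpha and d / alpha - C sqrt d
    increases with d.

    The rounding is a deterministic walk in the cube.  While there are about f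
    coordinates strictly between 0 and 1, every step is orthogonal to the few
    sets of size at most f / 256, to the all-one vector and to the current
    point; the remaining sets are watched by an exponential potential in which S
    has weight (f / |S|)^2.  Sparsity makes the total weight O(f).  A step is
    also orthogonal to the sets of largest potential, and among all admissible
    directions one is chosen along which the quadratic growth of the potential
    is below average.  The potential then grows by a constant factor only, so
    that S, of size at least f / 256, loses O(sqrt f * (1 + |log(|S| / f)|)) before
    f is divided by 16; these losses form a convergent series with sum
    O(sqrt |S|).

    Lower bound on s / alpha - d_T.  For q near 2 s one constructs an almost
    regular tournament on an abelian group of order q all of whose subtournaments
    of the relevant sizes are irregular ([irregular_tournament]); O(1) extra
    vertices adjust the order of the tournament to the integer part of alpha n.
    Almost all pairs of elements fall into the triangles with x + y + z = 0, and
    every triangle is oriented cyclically in one of its two ways, chosen at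
    random.  All out-degrees are then (q - 1) / 2 up to O(1), whatever the
    choices.  Fix a vertex set Y.  A triangle with exactly two vertices in Y
    perturbs the out-degrees inside Y, and there are many such triangles:
    otherwise Y would be close to a coset of a proper subgroup, but q is chosen
    so that all proper subgroups are too small ([many_open_pairs]).  Exposing
    these triangles vertex by vertex, each of linearly many out-degrees falls in
    a prescribed window of width epsilon sqrt q with conditional probability
    O(epsilon).  As the out-degrees inside Y have average (|Y| - 1) / 2, a lower
    bound for all of them forces most of them into such a window.  The
    probability of that event is at most (C epsilon)^(c q), which beats the 2^q
    choices of Y for small epsilon. *)

Set Implicit Arguments.
Unset Strict Implicit.
Unset Printing Implicit Defensive.

Import Order.TTheory GRing.Theory Num.Theory.

Local Open Scope ring_scope.

(** * Directions of slow growth *)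

(** The orthogonal projection onto the common kernel of the vectors [zs], built by
    Gram-Schmidt: each new vector subtracts a projection of rank at most one, so
    the trace drops by at most one. *)
Lemma projection_killing (R : realFieldType) (V : finType)
    (zs : seq {ffun V -> R}) :
  exists P : V -> V -> R,
    [/\ forall u v, P u v = P v u,
        forall u v, \sum_w P u w * P w v = P u v,
        forall z, z \in zs -> forall u, \sum_v P u v * z v = 0 &
        #|V|%:R - (size zs)%:R <= \sum_u P u u].
Proof.
elim: zs => [|z zs [P [Psym Pidem Pker Ptr]]].
  exists (fun u v => (u == v)%:R); split=> //.
  - by move=> u v; rewrite eq_sym.
  - move=> u v; rewrite (bigD1 u) //= eqxx mul1r big1 ?addr0 // => w wu.
    by rewrite eq_sym (negPf wu) mul0r.
  - rewrite subr0 (eq_bigr (fun=> 1)) => [|u _]; last by rewrite eqxx.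
    by rewrite sumr_const.
pose a u := \sum_v P u v * z v.
pose c := \sum_u a u * a u.
have Pa u : \sum_v P u v * a v = a u.
  rewrite /a; under eq_bigr => v _ do rewrite big_distrr /=.
  rewrite exchange_big /=; apply: eq_bigr => v _.
  by rewrite -Pidem big_distrl /=; apply: eq_bigr => w _; rewrite mulrA.
have [c0|cN0] := eqVneq c 0.
  exists P; split=> //; last first.
    by apply: le_trans Ptr; rewrite /= -addn1 natrD; lra.
  have a0 u : a u = 0.
    apply/eqP; rewrite -sqrf_eq0 expr2.
    by rewrite (psumr_eq0P _ c0) // => i _; rewrite -expr2 sqr_ge0.
  move=> z'; rewrite inE => /predU1P[-> u|]; [exact: a0 | exact: Pker].
have adj f g : \sum_v (\sum_u P v u * f u) * g v =
               \sum_u f u * (\sum_v P u v * g v) :> R.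
  transitivity (\sum_v \sum_u P v u * f u * g v).
    by apply: eq_bigr => v _; rewrite big_distrl.
  rewrite exchange_big /=; apply: eq_bigr => u _; rewrite big_distrr /=.
  by apply: eq_bigr => v _; rewrite Psym mulrCA mulrA.
have za : \sum_v a v * z v = c.
  rewrite [LHS](eq_bigr (fun v => z v * (\sum_u P v u * a u))); last first.
    by move=> v _; rewrite Pa mulrC.
  by rewrite -adj; apply: eq_bigr => v _; rewrite -/(a v).
have aE u : \sum_v P u v * z v = a u by [].
have cE : \sum_u a u * a u = c by [].
clearbody c; clearbody a.
exists (fun u v => P u v - a u * a v / c); split.
- by move=> u v; rewrite Psym; ring.
- move=> u v; transitivity (\sum_w P u w * P w v - a u / c * (\sum_w P v w * a w)
      - a v / c * (\sum_w P u w * a w) + a u * a v / c ^+ 2 * (\sum_w a w * a w)).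
    rewrite !big_distrr /= -!sumrB -big_split /=; apply: eq_bigr => w _.
    by rewrite (Psym w v); field.
  by rewrite Pidem !Pa cE; field.
- move=> z' z'in u.
  transitivity (\sum_v P u v * z' v - a u / c * (\sum_v a v * z' v)).
    by rewrite big_distrr /= -sumrB; apply: eq_bigr => v _; ring.
  move: z'in; rewrite inE => /predU1P[->|z'in].
    by rewrite za aE; field.
  have -> : \sum_v a v * z' v = \sum_v (\sum_u P v u * z u) * z' v.
    by apply: eq_bigr => v _; rewrite aE.
  by rewrite adj Pker // big1 ?mulr0 ?subrr // => v _; rewrite Pker // mulr0.
- rewrite sumrB -big_distrl /= cE divff // -addn1 natrD opprD addrA.
  by rewrite lerD2r.
Qed.

(** Averaging over the images P e_u of the basis vectors under the projection
    onto the admissible directions: their squared norms sum to the trace of P,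
    while for each [i] the squares of the sums over [S i] add up to the squared
    norm of the projected indicator of [S i], at most [#|F|].  Hence one of them
    is no worse than the ratio of the two totals. *)
Lemma balanced_direction (R : realFieldType) (V I : finType)
    (F : {set V}) (S : I -> {set V}) (W : I -> R) (zs : seq {ffun V -> R}) (K : R) :
  0 < K -> K <= #|F|%:R - (size zs)%:R -> (forall i, 0 <= W i) ->
  exists y : {ffun V -> R},
    [/\ 0 < \sum_v y v ^+ 2,
        forall v, v \notin F -> y v = 0,
        forall z, z \in zs -> \sum_v y v * z v = 0 &
        K * (\sum_i W i * (\sum_(v in S i) y v) ^+ 2) <=
          #|F|%:R * (\sum_i W i) * \sum_v y v ^+ 2].
Proof.
move=> K0 KF W0.
pose e u : {ffun V -> R} := [ffun v => (v == u)%:R].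
have [P [Psym Pidem Pker Ptr]] :=
  projection_killing (zs ++ [seq e u | u <- enum (~: F)]).
have {}Ptr : K <= \sum_u P u u.
  apply: le_trans KF (le_trans _ Ptr).
  by rewrite size_cat size_map -cardE -(cardsC F) !natrD; lra.
have PF u v : v \notin F -> P u v = 0.
  move=> vF; rewrite -[RHS](Pker (e v) _ u); last first.
    by rewrite mem_cat map_f ?orbT // mem_enum inE.
  rewrite (bigD1 v) //= ffunE eqxx mulr1 big1 ?addr0 // => w wv.
  by rewrite ffunE (negPf wv) mulr0.
pose y u : {ffun V -> R} := [ffun v => P u v].
have trE : \sum_u \sum_v y u v ^+ 2 = \sum_u P u u.
  apply: eq_bigr => u _; rewrite -Pidem; apply: eq_bigr => v _.
  by rewrite ffunE (Psym v) expr2.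
pose N u : R := \sum_v y u v ^+ 2; pose Q u : R := \sum_i W i * (\sum_(v in S i) y u v) ^+ 2.
have N0 u : 0 <= N u by apply: sumr_ge0 => v _; rewrite sqr_ge0.
have QF : \sum_u Q u <= #|F|%:R * \sum_i W i.
  rewrite /Q exchange_big big_distrr /=; apply: ler_sum => i _.
  rewrite -big_distrr /= mulrC ler_wpM2r //.
  pose c v : R := ((v \in S i) && (v \in F))%:R.
  have cc v : c v * c v = c v by rewrite -natrM mulnb andbb.
  pose b u := \sum_v P u v * c v.
  have -> : \sum_u (\sum_(v in S i) y u v) ^+ 2 = \sum_u b u ^+ 2.
    apply: eq_bigr => u _; congr (_ ^+ 2); rewrite big_mkcond /=.
    apply: eq_bigr => v _; rewrite ffunE /c; case: ifP => _ /=; rewrite ?mulr0 //.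
    by case: (boolP (v \in F)) => vF; rewrite ?mulr1 // PF // mul0r.
  have bbE : \sum_u b u ^+ 2 = \sum_u c u * b u.
    transitivity (\sum_u \sum_v P u v * c v * b u).
      by apply: eq_bigr => u _; rewrite expr2 {1}/b big_distrl.
    rewrite exchange_big /=; apply: eq_bigr => v _.
    transitivity (c v * \sum_u P v u * b u).
      by rewrite big_distrr; apply: eq_bigr => u _ /=; rewrite (Psym v); ring.
    congr (_ * _); rewrite {1}/b; under eq_bigr => u _ do rewrite big_distrr /=.
    rewrite exchange_big /=; apply: eq_bigr => w _; rewrite -Pidem big_distrl /=.
    by apply: eq_bigr => u _; rewrite mulrA.
  have : 0 <= \sum_u (c u - b u) ^+ 2 by apply: sumr_ge0 => u _; rewrite sqr_ge0.
  have -> : \sum_u (c u - b u) ^+ 2 =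
      \sum_u c u - 2 * (\sum_u c u * b u) + \sum_u b u ^+ 2.
    rewrite big_distrr /= -sumrB -big_split /=; apply: eq_bigr => u _.
    by rewrite -[X in _ = X - _ + _](cc u); ring.
  rewrite -bbE => h.
  suff : \sum_u c u <= #|F|%:R by lra.
  rewrite -sum1_card natr_sum [leRHS]big_mkcond; apply: ler_sum => u _.
  by rewrite /c; case: (u \in S i); case: (u \in F).
pose c := #|F|%:R * \sum_i W i.
have c0 : 0 <= c by rewrite mulr_ge0 ?sumr_ge0.
have /existsP[u /andP[Nu Qu]] : [exists u, (0 < N u) && (K * Q u <= c * N u)].
  apply: contraT => /existsPn noex.
  have le u : true -> 0 <= K * Q u - c * N u.
    move=> _; rewrite subr_ge0; have := noex u; rewrite negb_and => /orP[|]; last first.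
      by rewrite -ltNge => /ltW.
    rewrite -leNgt => Nu0; have -> : N u = 0 by apply/le_anti; rewrite Nu0 N0.
    by rewrite mulr0 mulr_ge0 ?(ltW K0)// sumr_ge0 // => i _; rewrite mulr_ge0 ?sqr_ge0.
  have trN : K <= \sum_u N u by rewrite trE.
  have sum0 : \sum_u (K * Q u - c * N u) = 0.
    apply/le_anti; rewrite sumr_ge0 // andbT sumrB -!big_distrr /= subr_le0.
    apply: le_trans (ler_wpM2l (ltW K0) QF) _.
    by rewrite mulrC ler_wpM2l.
  have all0 := psumr_eq0P le sum0.
  (* Strict reversal at a nonzero vector would contradict the vanishing sum. *)
  have NZ u : N u = 0.
    have := noex u; have /eqP := all0 u isT; rewrite subr_eq0 => /eqP ->.
    by rewrite lexx andbT -leNgt => Nu0; apply/le_anti; rewrite Nu0 N0.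
  by move: trN; rewrite big1 // leNgt K0.
exists (y u); split=> // [v vF|z zin]; first by rewrite ffunE PF.
rewrite -[RHS](Pker z _ u) ?mem_cat ?zin //.
by apply: eq_bigr => v _; rewrite ffunE.
Qed.

(** * One step of the walk in the cube *)

Definition floating (R : numDomainType) (V : finType) (x : {ffun V -> R}) : {set V} :=
  [set v | 0 < x v < 1].

Definition unit_cube (R : numDomainType) (V : finType) (x : {ffun V -> R}) : Prop :=
  forall v, 0 <= x v <= 1.

Lemma sqr_sum_le (R : realFieldType) (V : finType) (A : {set V}) (y : V -> R) :
  (\sum_(v in A) y v) ^+ 2 <= #|A|%:R * \sum_(v in A) y v ^+ 2.
Proof.
have [->|/set0Pn[v0 v0A]] := eqVneq A set0.
  by rewrite !big_set0 cards0 mul0r expr0n.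
have [s sE] : exists s, \sum_(v in A) y v = s by eexists.
rewrite sE.
have n0 : 0 < #|A|%:R :> R by rewrite ltr0n; apply/card_gt0P; exists v0.
have : 0 <= \sum_(v in A) (#|A|%:R * y v - s) ^+ 2.
  by apply: sumr_ge0 => v _; rewrite sqr_ge0.
have -> : \sum_(v in A) (#|A|%:R * y v - s) ^+ 2 =
    #|A|%:R * (#|A|%:R * (\sum_(v in A) y v ^+ 2) - s ^+ 2).
  transitivity (#|A|%:R ^+ 2 * (\sum_(v in A) y v ^+ 2)
      - 2 * #|A|%:R * s * (\sum_(v in A) y v) + \sum_(v in A) s ^+ 2).
    by rewrite !big_distrr /= -sumrB -big_split /=; apply: eq_bigr => v _; ring.
  by rewrite sumr_const sE -mulr_natl; ring.
by rewrite pmulr_rge0 // subr_ge0.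
Qed.

(** The step length is capped at 1 because the quadratic bound on the
    exponential potential is valid for short steps only. *)
Lemma move_to_boundary (R : realFieldType) (V : finType) (x y : {ffun V -> R}) :
  unit_cube x -> (forall v, v \notin floating x -> y v = 0) ->
  \sum_v y v ^+ 2 = 1 ->
  exists t, let x' : {ffun V -> R} := [ffun v => x v + t * y v] in
    [/\ 0 < t, t <= 1, unit_cube x', floating x' \subset floating x &
        t = 1 \/ (#|floating x'| < #|floating x|)%N].
Proof.
move=> xbox ysupp y1.
have yF v : y v != 0 -> 0 < x v < 1.
  by move=> yN0; have := contra_neqN (ysupp v) yN0; rewrite inE => /negPn.
pose r v := if 0 < y v then (1 - x v) / y v else - (x v / y v).
have r0 v : y v != 0 -> 0 < r v.
  move=> yN0; have /andP[x0 x1] := yF _ yN0.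
  rewrite /r; case: (ltP 0 (y v)) => [y0|yle]; first by rewrite divr_gt0 ?subr_gt0.
  have y0 : y v < 0 by rewrite lt_neqAle yN0.
  by rewrite -mulrN -invrN divr_gt0 // oppr_gt0.
have stay t v : 0 < t -> (y v != 0 -> t <= r v) -> 0 <= x v + t * y v <= 1.
  move=> t0; have [-> _|yN0 /(_ isT)] := eqVneq (y v) 0.
    by rewrite mulr0 addr0.
  have /andP[x0 x1] := yF _ yN0.
  rewrite /r; case: (ltP 0 (y v)) => [y0|yle].
    rewrite ler_pdivlMr // => h; apply/andP; split; last by lra.
    by rewrite addr_ge0 ?mulr_ge0 // ltW.
  have y0 : 0 < - y v by rewrite oppr_gt0 lt_neqAle yN0.
  rewrite -mulrN -invrN ler_pdivlMr // => h; apply/andP; split; first lra.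
  have : 0 < t * - y v by rewrite mulr_gt0.
  lra.
have sub t v : 0 < t -> 0 < x v + t * y v < 1 -> 0 < x v < 1.
  by move=> t0; have [->|/yF //] := eqVneq (y v) 0; rewrite mulr0 addr0.
have [v0 yv0] : exists v, y v != 0.
  apply/existsP; apply: contraT => /existsPn noex.
  move: y1; rewrite big1 => [/esym/eqP|v _]; first by rewrite oner_eq0.
  by have := noex v; rewrite negbK => /eqP->; rewrite expr0n.
case: (@arg_minP _ _ _ v0 (fun v => y v != 0) r yv0) => v1 yv1 rmin.
have [r1|r1] := leP 1 (r v1).
  exists 1 => x'; split=> //.
  - by move=> v; rewrite ffunE; apply: stay => // /rmin; exact: le_trans.
  - by apply/subsetP => v; rewrite !inE ffunE; exact: sub.
  - by left.
exists (r v1) => x'; have rv0 := r0 _ yv1.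
have sb : floating x' \subset floating x.
  by apply/subsetP => v; rewrite !inE ffunE; exact: sub.
split=> //; first exact: ltW.
  by move=> v; rewrite ffunE; apply: stay => // /rmin.
right; apply: proper_card; apply/properP; split=> //.
exists v1; rewrite inE ?yF // ffunE /r.
case: (ltP 0 (y v1)) => [y0|yle].
  by rewrite divfK // addrC subrK ltxx andbF.
by rewrite mulNr divfK // subrr ltxx.
Qed.

Lemma expR_le_quadratic (R : realType) (z : R) :
  z <= 2^-1 -> expR z <= 1 + z + 2 * z ^+ 2.
Proof.
move=> z2; have z1 : 0 < 1 - z by lra.
have h : 1 <= (1 - z) * (1 + z + 2 * z ^+ 2).
  have -> : (1 - z) * (1 + z + 2 * z ^+ 2) = 1 + z ^+ 2 * (1 - 2 * z) by ring.
  by rewrite lerDl mulr_ge0 ?sqr_ge0 //; lra.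
have e : expR z * (1 - z) <= 1.
  rewrite [leRHS](_ : 1 = expR z * expR (- z)); last by rewrite -expRD subrr expR0.
  rewrite ler_pM2l ?expR_gt0 //.
  exact: expR_ge1Dx.
rewrite -(ler_pM2r z1); apply: le_trans e _; by rewrite mulrC.
Qed.

Definition total (R : nmodType) (V : finType) (A : {set V}) (x : {ffun V -> R}) : R :=
  \sum_(v in A) x v.

(** The potential is the sum of [W i * expR (lam * drop i)].  The sign of the
    direction is chosen to make its linear variation nonpositive, so only the
    quadratic variation remains, controlled by [balanced_direction].  Sets
    carrying more than a fraction 1 / [t] of the potential are blocked; there are
    at most [t] of them, and the others can at most double.  Orthogonality to
    [x] makes the squared norm increase by the squared length of the step: it is
    the clock of the walk. *)
Lemma walk_step (R : realType) (V I : finType) (S : I -> {set V})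
    (fixed : {set I}) (W : I -> R) (lam f t : R) (x : {ffun V -> R}) :
  unit_cube x -> #|floating x|%:R <= f -> 0 < f -> 0 < t ->
  (forall i, 0 <= W i) ->
  0 <= lam -> 4 * lam ^+ 2 * f <= 1 ->
  2 + #|fixed|%:R + t + f / 32 <= #|floating x|%:R ->
  exists x' : {ffun V -> R}, let drop i := total (S i) x - total (S i) x' in
    let grow := \sum_v x' v ^+ 2 - \sum_v x v ^+ 2 in
    [/\ unit_cube x', floating x' \subset floating x,
        forall v, v \notin floating x -> x' v = x v,
        \sum_v x' v = \sum_v x v &
    [/\ forall i, i \in fixed -> drop i = 0,
        forall i, drop i = 0 \/
          W i * expR (lam * drop i) <= 2 / t * \sum_j W j,
        \sum_i W i * expR (lam * drop i) <= (\sum_i W i) * expR (16 / f * grow),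
        0 < grow &
        grow = 1 \/ (#|floating x'| < #|floating x|)%N]].
Proof.
move=> xbox Ff f0 t0 W0 lam0 lamf bigF.
set F := floating x in Ff bigF *.
pose Phi := \sum_j W j.
have Phi0 : 0 <= Phi by apply: sumr_ge0.
pose top := [set i | Phi < t * W i].
have ind (A : {set V}) (z : {ffun V -> R}) :
    \sum_v z v * [ffun v => (v \in A)%:R : R] v = total A z.
  rewrite /total [RHS]big_mkcond; apply: eq_bigr => v _; rewrite ffunE.
  by case: (v \in A); rewrite ?mulr1 ?mulr0.
have top_small : #|top|%:R <= t.
  have [->|/set0Pn[i0 i0top]] := eqVneq top set0; first by rewrite cards0 ltW.
  have Phi1 : 0 < Phi.
    rewrite lt_neqAle Phi0 andbT eq_sym; apply: contraTneq i0top => PhiE.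
    rewrite inE PhiE -leNgt pmulr_rle0 // -PhiE.
    by rewrite PhiE; have /(_ i0 isT)-> := psumr_eq0P (fun i _ => W0 i) PhiE.
  rewrite -(ler_pM2r Phi1).
  have -> : #|top|%:R * Phi = \sum_(i in top) Phi by rewrite sumr_const mulr_natl.
  apply: le_trans (_ : \sum_(i in top) t * W i <= _).
    by apply: ler_sum => i; rewrite inE => /ltW.
  rewrite -big_distrr /= ler_wpM2l ?(ltW t0) // /Phi [leRHS](bigID (mem top)) /=.
  by rewrite lerDl sumr_ge0.
pose one (A : {set V}) : {ffun V -> R} := [ffun v => (v \in A)%:R].
pose zs := one setT :: x :: [seq one (S i) | i <- enum (fixed :|: top)].
(* The dimension left after blocking: this is what the size hypothesis buys. *)
have zsK : f / 32 <= #|F|%:R - (size zs)%:R.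
  have -> : size zs = (#|fixed :|: top| + 2)%N by rewrite /= size_map -cardE addn2.
  rewrite natrD.
  have : (#|fixed :|: top|%:R : R) <= #|fixed|%:R + #|top|%:R.
    by rewrite -natrD ler_nat leq_card_setU.
  lra.
have K0 : 0 < f / 32 by rewrite divr_gt0.
have [y0 [N0 y0F y0zs y0W]] := balanced_direction S K0 zsK W0.
pose nu := Num.sqrt (\sum_v y0 v ^+ 2).
have nu0 : 0 < nu by rewrite sqrtr_gt0.
have nu2 : nu ^+ 2 = \sum_v y0 v ^+ 2 by rewrite sqr_sqrtr // ltW.
pose sgn : R := if 0 <= \sum_i W i * total (S i) y0 then 1 else -1.
have sgn2 : sgn ^+ 2 = 1 by rewrite /sgn; case: ifP; rewrite ?sqrrN expr1n.
pose c := sgn / nu.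
pose y : {ffun V -> R} := [ffun v => c * y0 v].
have toty A : total A y = c * total A y0.
  by rewrite /total big_distrr; apply: eq_bigr => v _; rewrite ffunE.
have y1 : \sum_v y v ^+ 2 = 1.
  transitivity (c ^+ 2 * \sum_v y0 v ^+ 2).
    by rewrite big_distrr /=; apply: eq_bigr => v _; rewrite ffunE exprMn.
  by rewrite -nu2 /c exprMn sgn2 mul1r exprVn mulVf // expf_neq0 // gt_eqF.
have yF v : v \notin F -> y v = 0 by move=> vF; rewrite ffunE y0F // mulr0.
have yzs z : z \in zs -> \sum_v y v * z v = 0.
  move=> zin; transitivity (c * \sum_v y0 v * z v); last by rewrite y0zs // mulr0.
  by rewrite big_distrr /=; apply: eq_bigr => v _; rewrite ffunE mulrA.
have yW : \sum_i W i * total (S i) y ^+ 2 <= 32 * Phi.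
  have -> : \sum_i W i * total (S i) y ^+ 2 =
      c ^+ 2 * \sum_i W i * total (S i) y0 ^+ 2.
    by rewrite big_distrr /=; apply: eq_bigr => i _; rewrite toty /=; ring.
  rewrite /c exprMn sgn2 mul1r exprVn mulrC ler_pdivrMr ?exprn_gt0 // nu2.
  have : f / 32 * (\sum_i W i * total (S i) y0 ^+ 2) <=
         f * (Phi * \sum_v y0 v ^+ 2).
    apply: le_trans y0W _; rewrite -mulrA ler_wpM2r //.
    by rewrite mulr_ge0 // ltW.
  rewrite -[X in X <= _]mulrA ler_pM2l //; lra.
have ylin : 0 <= \sum_i W i * total (S i) y.
  have -> : \sum_i W i * total (S i) y = c * \sum_i W i * total (S i) y0.
    by rewrite big_distrr /=; apply: eq_bigr => i _; rewrite toty mulrCA.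
  rewrite /c -mulrA mulrCA mulr_ge0 ?invr_ge0 ?(ltW nu0) //.
  rewrite /sgn; case: ifP => [|/negbT]; first by rewrite mul1r.
  by rewrite -ltNge => /ltW; rewrite mulN1r oppr_ge0.
have [tau [tau0 tau1 x'box x'F x'end]] := move_to_boundary xbox yF y1.
exists [ffun v => x v + tau * y v] => drop grow.
have totx' A : total A x - total A [ffun v => x v + tau * y v] = - (tau * total A y).
  rewrite /total big_distrr /= -sumrB -sumrN; apply: eq_bigr => v _.
  by rewrite ffunE; ring.
have sumy : \sum_v y v = 0.
  transitivity (\sum_v y v * one setT v); last by rewrite yzs ?inE ?eqxx.
  by apply: eq_bigr => v _; rewrite [one _ _]ffunE inE mulr1.
have xy : \sum_v y v * x v = 0 by apply: yzs; rewrite !inE eqxx orbT.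
have growE : grow = tau ^+ 2.
  transitivity (2 * tau * (\sum_v y v * x v) + tau ^+ 2 * \sum_v y v ^+ 2).
    rewrite /grow !big_distrr /= -sumrB -big_split /=; apply: eq_bigr => v _.
    by rewrite !ffunE; ring.
  by rewrite xy y1 mulr0 add0r mulr1.
have blocked i : i \in fixed :|: top -> drop i = 0.
  move=> iT; rewrite /drop totx' -ind yzs ?mulr0 ?oppr0 // !inE map_f ?orbT //.
  by rewrite mem_enum.
(* Cauchy-Schwarz on the floating part of [S i], with the norm of [y] equal to 1. *)
have lamd i : `|lam * drop i| <= 2^-1.
  rewrite -(@ler_pXn2r _ 2) ?nnegrE ?normr_ge0 ?invr_ge0 //.
  rewrite real_normK ?num_real // /drop totx'.
  have yA : total (S i) y ^+ 2 <= f.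
    have -> : total (S i) y = \sum_(v in S i :&: F) y v.
      rewrite /total (big_setID F) /= [X in _ + X]big1 ?addr0 // => v.
      by rewrite inE => /andP[/yF].
    apply: le_trans (sqr_sum_le _ _) _.
    apply: le_trans (_ : #|F|%:R * 1 <= _); last by rewrite mulr1.
    apply: ler_pM => //; first by apply: sumr_ge0 => v _; rewrite sqr_ge0.
      by rewrite ler_nat subset_leq_card // subsetIr.
    rewrite -y1 [leRHS](bigID (mem (S i :&: F))) /= lerDl.
    by apply: sumr_ge0 => v _; rewrite sqr_ge0.
  have h : (lam * - (tau * total (S i) y)) ^+ 2 <= lam ^+ 2 * f.
    rewrite !(sqrrN, exprMn) ler_wpM2l ?sqr_ge0 //.
    apply: le_trans yA; rewrite -[leRHS]mul1r ler_wpM2r ?sqr_ge0 //.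
    by rewrite expr_le1 // ltW.
  apply: le_trans h _; rewrite exprVn; lra.
split=> //.
- by move=> v vF; rewrite ffunE yF // mulr0 addr0.
- transitivity (\sum_v x v + tau * \sum_v y v); last by rewrite sumy mulr0 addr0.
  by rewrite big_distrr /= -big_split; apply: eq_bigr => v _; rewrite ffunE.
split.
- by move=> i iF; apply: blocked; rewrite inE iF.
- move=> i; have [iT|iT] := boolP (i \in fixed :|: top); [left; exact: blocked|right].
  have : expR (lam * drop i) <= 2.
    have /ler_normlP[_ h] := lamd i.
    apply: le_trans (expR_le_quadratic h) _.
    have := lamd i; rewrite -(@ler_pXn2r _ 2) ?nnegrE ?normr_ge0 ?invr_ge0 //.
    by rewrite real_normK ?num_real // exprVn; lra.
  move: iT; rewrite !inE negb_or -leNgt => /andP[_ iT].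
  move=> /(ler_wpM2l (W0 i)) /le_trans; apply.
  by rewrite mulrC -mulrA ler_pM2l // ler_pdivlMl.
- rewrite growE.
  apply: le_trans (_ : \sum_i W i * (1 + lam * drop i + 2 * (lam * drop i) ^+ 2) <= _).
    apply: ler_sum => i _; rewrite ler_wpM2l //; apply: expR_le_quadratic.
    by have /ler_normlP[] := lamd i.
  have -> : \sum_i W i * (1 + lam * drop i + 2 * (lam * drop i) ^+ 2) =
      Phi - lam * tau * (\sum_i W i * total (S i) y)
      + 2 * lam ^+ 2 * tau ^+ 2 * \sum_i W i * total (S i) y ^+ 2.
    rewrite !big_distrr /= -sumrB -big_split /=; apply: eq_bigr => i _.
    by rewrite /drop totx'; ring.
  apply: le_trans (_ : Phi * (1 + 16 / f * tau ^+ 2) <= _); last first.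
    by rewrite ler_wpM2l // expR_ge1Dx.
  have h1 : 0 <= lam * tau * (\sum_i W i * total (S i) y).
    by rewrite !mulr_ge0 // ltW.
  have h2 : 2 * lam ^+ 2 * tau ^+ 2 * (\sum_i W i * total (S i) y ^+ 2) <=
      2 * lam ^+ 2 * tau ^+ 2 * (32 * Phi).
    by rewrite ler_wpM2l // mulr_ge0 ?sqr_ge0 // mulr_ge0 ?sqr_ge0.
  have h3 : 64 * lam ^+ 2 <= 16 / f by rewrite ler_pdivlMr //; lra.
  have h4 : 64 * lam ^+ 2 * (tau ^+ 2 * Phi) <= 16 / f * (tau ^+ 2 * Phi).
    by rewrite ler_wpM2r // mulr_ge0 ?sqr_ge0.
  lra.
- by rewrite growE exprn_gt0.
- by case: x'end => [tE|]; [left; rewrite growE tE expr1n|right].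
Qed.

(** * The walk until few coordinates are floating *)

(** Each step either fixes a coordinate or increases the squared norm by 1, so
    the walk ends.  The squared norm increases in total by at most the initial
    number of floating coordinates, so the potential grows at most by the factor
    [expR 16]; and a set whose own term exceeds the fraction 1 / [t] of the
    potential is blocked until it no longer does. *)
Lemma walk (R : realType) (V I : finType) (S : I -> {set V})
    (fixed : {set I}) (a : I -> R) (lam f t : R) (g : nat) (x0 : {ffun V -> R}) :
  unit_cube x0 -> #|floating x0|%:R <= f -> 0 < f -> 0 < t ->
  (forall i, 0 <= a i) ->
  0 <= lam -> 4 * lam ^+ 2 * f <= 1 ->
  2 + #|fixed|%:R + t + f / 32 <= g%:R ->
  exists x : {ffun V -> R}, let drop i := total (S i) x0 - total (S i) x in
    [/\ unit_cube x, (#|floating x| <= g)%N,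
        \sum_v x v = \sum_v x0 v,
        forall i, i \in fixed -> drop i = 0 &
        forall i, a i * expR (lam * drop i) <=
          Num.max (a i) (2 / t * expR 16 * \sum_j a j)].
Proof.
move=> x0box Ff f0 t0 a0 lam0 lamf bigF.
pose drop (x : {ffun V -> R}) i := total (S i) x0 - total (S i) x.
pose norm2 (x : {ffun V -> R}) := \sum_v x v ^+ 2.
pose bound i := Num.max (a i) (2 / t * expR 16 * \sum_j a j).
pose Inv (x : {ffun V -> R}) : Prop :=
  [/\ [/\ unit_cube x, floating x \subset floating x0 &
          forall v, v \notin floating x0 -> x v = x0 v],
      \sum_v x v = \sum_v x0 v,
      forall i, i \in fixed -> drop x i = 0,
      forall i, a i * expR (lam * drop x i) <= bound i &
      \sum_i a i * expR (lam * drop x i) <=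
        (\sum_i a i) * expR (16 / f * (norm2 x - norm2 x0))].
have Inv0 : Inv x0.
  have d0 i : drop x0 i = 0 by rewrite /drop subrr.
  split=> //.
  - by move=> i; rewrite d0 mulr0 expR0 mulr1 /bound le_max lexx.
  - by rewrite subrr mulr0 expR0 mulr1 ler_sum // => i _; rewrite d0 mulr0 expR0 mulr1.
(* Only the coordinates floating at the start can change. *)
have norm_le x : Inv x -> norm2 x - norm2 x0 <= f.
  move=> [[xbox xsub xfr] _ _ _ _]; apply: le_trans Ff.
  rewrite /norm2 -sumrB -sum1_card natr_sum [leRHS]big_mkcond /=.
  apply: ler_sum => v _; case: ifP => [_|/negbT/xfr->]; last by rewrite subrr.
  have /andP[h1 h2] := xbox v; have : x v ^+ 2 <= 1 by rewrite expr_le1.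
  by have := sqr_ge0 (x0 v); lra.
have normV x : unit_cube x -> norm2 x <= #|V|%:R.
  move=> xbox; rewrite /norm2 -sum1_card natr_sum; apply: ler_sum => v _.
  by have /andP[h1 h2] := xbox v; rewrite expr_le1.
have step x : Inv x -> (g < #|floating x|)%N ->
    exists x', Inv x' /\
      #|floating x'|%:R - norm2 x' + 1 <= #|floating x|%:R - norm2 x.
  move=> xInv gF; have [[xbox xsub xfr] xsum xfix xW xPhi] := xInv.
  pose W i := a i * expR (lam * drop x i).
  have W0 i : 0 <= W i by rewrite mulr_ge0 ?expR_ge0.
  have Ff' : #|floating x|%:R <= f.
    by apply: le_trans Ff; rewrite ler_nat subset_leq_card.
  have bigF' : 2 + #|fixed|%:R + t + f / 32 <= #|floating x|%:R.
    by apply: le_trans bigF _; rewrite ler_nat ltnW.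
  have [x' [x'box x'sub x'fr x'sum [x'fix x'W x'Phi grow0 x'end]]] :=
    walk_step S xbox Ff' f0 t0 W0 lam0 lamf bigF'.
  have dropE i : drop x' i = drop x i + (total (S i) x - total (S i) x').
    by rewrite /drop; ring.
  have WE i : a i * expR (lam * drop x' i) =
      W i * expR (lam * (total (S i) x - total (S i) x')).
    by rewrite dropE mulrDr expRD mulrA.
  have PhiE16 : \sum_i W i <= expR 16 * \sum_i a i.
    apply: le_trans xPhi _; rewrite mulrC ler_wpM2r ?sumr_ge0 //.
    rewrite ler_expR mulrAC ler_pdivrMr // ler_pM2l //; exact: norm_le.
  exists x'; split; last first.
    have fF : (#|floating x'| <= #|floating x|)%N by rewrite subset_leq_card.
    case: x'end => [g1|lt]; move: grow0; rewrite -/(norm2 x') -/(norm2 x).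
      move: g1 fF; rewrite -/(norm2 x') -/(norm2 x) -(ler_nat R); lra.
    by move: lt; rewrite -(ler_nat R) -addn1 natrD; lra.
  split=> //.
  - split=> //; first exact: subset_trans x'sub xsub.
    move=> v vF; rewrite x'fr ?xfr //; apply: contra vF; exact: (subsetP xsub).
  - by rewrite x'sum.
  - by move=> i iF; rewrite dropE xfix // x'fix // addr0.
  - move=> i; rewrite WE; case: (x'W i) => [->|h].
      by rewrite mulr0 expR0 mulr1; exact: xW.
    rewrite /bound le_max; apply/orP; right; apply: le_trans h _.
    by rewrite -[leRHS]mulrA ler_wpM2l // divr_ge0 ?ltW.
  - rewrite (eq_bigr _ (fun i _ => WE i)); apply: le_trans x'Phi _.
    rewrite -/(norm2 x') -/(norm2 x).
    have -> : norm2 x' - norm2 x0 = (norm2 x - norm2 x0) + (norm2 x' - norm2 x).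
      by ring.
    by rewrite [X in _ <= _ * expR X]mulrDr [X in _ <= _ * X]expRD [leRHS]mulrA ler_wpM2r ?expR_ge0.
have iter N x : Inv x -> #|floating x|%:R + #|V|%:R - norm2 x <= N%:R ->
    exists x', Inv x' /\ (#|floating x'| <= g)%N.
  elim: N x => [|N IH] x xInv h.
    exists x; split=> //.
    have xbox : unit_cube x by case: xInv => [[]].
    have nV := normV x xbox.
    have : #|floating x|%:R <= 0 :> R by lra.
    by rewrite (ler_nat R _ 0) leqn0 => /eqP->.
  have [|gF] := leqP #|floating x| g; first by exists x.
  have [x' [x'Inv hx']] := step x xInv gF.
  by apply: IH x'Inv _; move: h; rewrite -addn1 natrD; lra.
have start : #|floating x0|%:R + #|V|%:R - norm2 x0 <= (#|floating x0| + #|V|)%:R.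
  by rewrite natrD gerBl /norm2 sumr_ge0 // => v _; exact: sqr_ge0.
have [x [[[xbox _ _] xsum xfix xW _] xF]] := iter _ _ Inv0 start.
by exists x.
Qed.

(** * Sparse families: sizes of the constants *)

Definition sparse (I : finType) (d : I -> nat) : Prop :=
  forall D, (#|[set i | d i <= D]| <= 2 * D + 1)%N.

(** In a subset of size k some [d i] is at least (k - 1) / 2; removing the index of
    the largest [d i] one by one compares the sum with a telescoping one. *)
Lemma sum_inv_sqr_le (R : realFieldType) (I : finType) (d : I -> nat) (D : nat) :
  sparse d -> (0 < D)%N ->
  \sum_(i | (D < d i)%N) (d i)%:R ^- 2 <= 16 / D%:R :> R.
Proof.
move=> dsp D0.
have D1 : 1 <= D%:R :> R by rewrite ler1n.
have gen n (A : {set I}) : #|A| = n -> {in A, forall i, (D <= d i)%N} ->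
    \sum_(i in A) (d i)%:R ^- 2 <=
    16 * ((2 * D%:R - 1)^-1 - (2 * D%:R + n%:R - 1)^-1) :> R.
  elim: n A => [|n IH] A cA Ad.
    by move/cards0_eq: cA => ->; rewrite big_set0 addr0 subrr mulr0.
  have /card_gt0P[i0 i0A] : (0 < #|A|)%N by rewrite cA.
  case: (arg_maxnP (P := mem A) d i0A) => i /= iA imax.
  rewrite (bigD1 i iA) /=.
  have -> : \sum_(j in A | j != i) ((d j)%:R : R) ^- 2 = \sum_(j in A :\ i) (d j)%:R ^- 2.
    by apply: eq_bigl => j; rewrite !inE andbC.
  have cA' : #|A :\ i| = n by move: cA; rewrite (cardsD1 i) iA => -[].
  have Ad' : {in A :\ i, forall j, (D <= d j)%N}.
    by move=> j; rewrite inE => /andP[_]; exact: Ad.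
  (* Both [D <= d i] and [n <= 2 * d i] hold for the largest degree. *)
  have h : (2 * D + n <= 4 * d i)%N.
    have sub : A \subset [set j | d j <= d i]%N.
      by apply/subsetP => j jA; rewrite inE; exact: imax.
    have := leq_trans (subset_leq_card sub) (dsp (d i)); rewrite cA.
    by have := Ad i iA; lia.
  have {}h : 2 * D%:R + n%:R <= 4 * (d i)%:R :> R.
    by rewrite -!natrM -natrD ler_nat.
  have {}IH := IH _ cA' Ad'; rewrite -[n.+1%:R]natr1.
  pose u : R := 2 * D%:R + n%:R; rewrite -/u in h.
  have n0 : 0 <= n%:R :> R by rewrite ler0n.
  have u2 : 2 <= u by rewrite /u; lra.
  have di0 : 0 < (d i)%:R :> R by lra.
  have e1 : (d i)%:R ^- 2 <= 16 * (u ^- 2).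
    have -> : 16 * u ^- 2 = ((u / 4) ^+ 2)^-1 by field; lra.
    have u4 : 0 < u / 4 by lra.
    by rewrite lef_pV2 ?posrE ?exprn_gt0 // ler_pXn2r ?nnegrE ?(ltW u4) //; lra.
  have e2 : u ^- 2 <= (u - 1)^-1 - u^-1.
    have -> : (u - 1)^-1 - u^-1 = (u * (u - 1))^-1 by field; apply/andP; split; lra.
    rewrite lef_pV2 ?posrE ?exprn_gt0 ?mulr_gt0 // ?ler_pM2l //; lra.
  have -> : 2 * D%:R + (n%:R + 1) - 1 = u :> R by rewrite /u; ring.
  rewrite -/u in IH.
  lra.
have := gen _ [set i | D < d i]%N erefl.
have -> : \sum_(i in [set i | (D < d i)%N]) ((d i)%:R : R) ^- 2 =
   \sum_(i | (D < d i)%N) (d i)%:R ^- 2 by apply: eq_bigl => i; rewrite inE.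
move=> /(_ (fun i => _)) h; apply: le_trans (h _) _ => [i|]; first by rewrite inE => /ltnW.
rewrite ler_pM2l //.
have h1 : 0 <= (2 * D%:R + #|[set i | (D < d i)%N]|%:R - 1)^-1 :> R.
  by rewrite invr_ge0; have : 0 <= #|[set i | (D < d i)%N]|%:R :> R by []; lra.
have h2 : (2 * D%:R - 1)^-1 <= D%:R^-1 :> R by rewrite lef_pV2 ?posrE //; lra.
lra.
Qed.

Definition walk_constant (R : realType) : R := 2 * (64 * 64 * 64) * expR 16.

Lemma walk_constant_ge (R : realType) : 256 * 256 <= walk_constant R.
Proof.
have : 1 <= expR 16 :> R by apply: le_trans (expR_ge1Dx _); lra.
rewrite /walk_constant; lra.
Qed.

(** Writing f for 16 ^ (k + 3), the weight of a large set is (f / #|S i|)^2, and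
    its final term is at most the constant [M].  This bounds the drop by
    sqrt f * log(#|S i| / f) up to a constant; the logarithm is replaced with a
    fourth root, using (z / 8)^8 <= exp z, so that the drops of successive stages
    form a geometric progression. *)
Lemma walk_stage (R : realType) (V I : finType) (S : I -> {set V})
    (q : I -> R) (k : nat) (x0 : {ffun V -> R}) :
  sparse (fun i => #|S i|) ->
  (forall i, 0 <= q i) -> (forall i, q i ^+ 4 = #|S i|%:R) ->
  unit_cube x0 -> (#|floating x0| <= 16 ^ k.+3)%N ->
  exists x : {ffun V -> R}, let drop i := total (S i) x0 - total (S i) x in
    [/\ unit_cube x, (#|floating x| <= 16 ^ k.+2)%N,
        \sum_v x v = \sum_v x0 v,
        forall i, (#|S i| <= 16 ^ k.+1)%N -> drop i = 0 &
        forall i, (16 ^ k.+1 < #|S i|)%N ->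
          drop i <= 16 * walk_constant R * 2 ^+ k.+3 * q i].
Proof.
move=> Ssp q0 q4 x0box Ff.
pose M : R := walk_constant R; have M1 := walk_constant_ge R; rewrite -/M in M1 *.
have ME : M = 2 * (64 * 64 * 64) * expR 16 by [].
clearbody M.
pose D := (16 ^ k.+1)%N; pose D' : R := D%:R.
have D16 : 16 <= D' by rewrite ler_nat /D expnS leq_pmulr // expn_gt0.
have D0 : (0 < D)%N by rewrite expn_gt0.
pose f : R := 256 * D'.
have fE : (16 ^ k.+3)%:R = f :> R.
  by rewrite /f /D' -natrM; congr _%:R; rewrite /D !(expnS _ k.+1, expnS _ k.+2); lia.
have gE : (16 ^ k.+2)%:R = 16 * D' :> R by rewrite -natrM -expnS.
pose fixed := [set i | #|S i| <= D]%N.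
pose a i : R := if i \in fixed then 0 else f ^+ 2 * #|S i|%:R ^- 2.
pose lam : R := (2 * 4 ^+ k.+3)^-1.
have f0 : 0 < f by rewrite /f; lra.
have p4 : (4 ^+ k.+3) ^+ 2 = f :> R.
  rewrite -fE natrX exprAC; congr (_ ^+ _); ring.
have p2 : (2 ^+ k.+3) ^+ 4 = f :> R.
  rewrite -fE natrX exprAC; congr (_ ^+ _); ring.
have f40 : 0 < 4 ^+ k.+3 :> R by rewrite exprn_gt0.
have f20 : 0 < 2 ^+ k.+3 :> R by rewrite exprn_gt0.
have lam0 : 0 < lam by rewrite invr_gt0 mulr_gt0.
have lamf : 4 * lam ^+ 2 * f <= 1.
  by rewrite /lam exprVn exprMn -p4 le_eqVlt; apply/orP; left; apply/eqP; field; lra.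
have a0 i : 0 <= a i.
  by rewrite /a; case: ifP => // _; rewrite mulr_ge0 ?invr_ge0 ?exprn_ge0 // ltW.
have suma : \sum_i a i <= 64 * 64 * f.
  have -> : \sum_i a i = f ^+ 2 * \sum_(i | (D < #|S i|)%N) #|S i|%:R ^- 2.
    rewrite big_distrr /= [RHS]big_mkcond /=; apply: eq_bigr => i _.
    by rewrite /a inE leqNgt; case: ltnP.
  apply: le_trans (ler_wpM2l _ (sum_inv_sqr_le R Ssp D0)) _; first by rewrite sqr_ge0.
  by rewrite -/D' mulrA ler_pdivrMr; [rewrite /f; lra | lra].
(* Here [3 <= f / 128] is needed, which is where the exponent [k.+3] comes from. *)
have count : 2 + #|fixed|%:R + f / 64 + f / 32 <= (16 ^ k.+2)%:R.
  have : (#|fixed|%:R : R) <= (2 * D + 1)%:R by rewrite ler_nat; exact: Ssp.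
  by rewrite natrD natrM -/D' gE /f; lra.
have [||x [xbox xF xsum xfix xW]] :=
  @walk R V I S fixed a lam f (f / 64) (16 ^ k.+2)%N x0 x0box _ f0 _ a0 (ltW lam0) lamf count.
- by rewrite -fE ler_nat.
- by rewrite divr_gt0.
exists x => drop; split=> //.
  by move=> i iD; apply: xfix; rewrite inE.
move=> i iD; have [d0|d0] := leP (drop i) 0.
  by apply: le_trans d0 _; apply: mulr_ge0 (q0 i); apply: mulr_ge0 (ltW f20); lra.
have iN : i \notin fixed by rewrite inE -ltnNge.
have d' : D' <= #|S i|%:R by rewrite ler_nat ltnW.
have aM : a i <= M.
  rewrite /a (negPf iN) ler_pdivrMr ?exprn_gt0 //; last by lra.
  have h : f ^+ 2 <= 256 * 256 * #|S i|%:R ^+ 2.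
    have -> : 256 * 256 * #|S i|%:R ^+ 2 = (256 * #|S i|%:R) ^+ 2 :> R by ring.
    have f256 : f <= 256 * #|S i|%:R by rewrite /f; lra.
    by rewrite ler_pXn2r ?nnegrE //; lra.
  by apply: le_trans h _; rewrite ler_wpM2r ?sqr_ge0 //; lra.
have WM : a i * expR (lam * drop i) <= M.
  apply: le_trans (xW i) _; rewrite ge_max aM /=.
  apply: le_trans (_ : 2 / (f / 64) * expR 16 * (64 * 64 * f) <= _).
    by rewrite ler_wpM2l // mulr_ge0 ?expR_ge0 // divr_ge0 // divr_ge0 // ltW.
  rewrite ME le_eqVlt; apply/orP; left; apply/eqP; field; lra.
pose z := lam * drop i; have z0 : 0 < z by rewrite mulr_gt0.
have z8 : (z / 8) ^+ 8 <= expR z.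
  have -> : expR z = expR (z / 8) ^+ 8.
    by rewrite -expRM_natl; congr expR; field.
  rewrite ler_pXn2r ?nnegrE ?expR_ge0 ?divr_ge0 ?ltW //.
  by have := expR_ge1Dx (z / 8); lra.
(* The eighth power of the right-hand side is M^8 (#|S i| / f)^2. *)
have key : z / 8 <= M * q i / 2 ^+ k.+3.
  have zge : 0 <= z / 8 by lra.
  have M0 : 0 <= M by lra.
  have rge : 0 <= M * q i / 2 ^+ k.+3 := divr_ge0 (mulr_ge0 M0 (q0 i)) (ltW f20).
  rewrite -(@ler_pXn2r _ 8) ?nnegrE //.
  apply: le_trans z8 _; rewrite expr_div_n exprMn.
  have -> : q i ^+ 8 = #|S i|%:R ^+ 2 by rewrite -q4 -exprM.
  have -> : (2 ^+ k.+3) ^+ 8 = f ^+ 2 :> R by rewrite -p2 -[RHS]exprM.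
  apply: le_trans (_ : M * (#|S i|%:R ^+ 2 / f ^+ 2) <= _).
    move: WM; rewrite /a (negPf iN) -/z.
    rewrite mulrAC ler_pdivrMr ?exprn_gt0 //; last by lra.
    by move=> h; rewrite mulrA ler_pdivlMr ?exprn_gt0 // mulrC.
  rewrite mulrA ler_wpM2r ?invr_ge0 ?sqr_ge0 // ler_wpM2r ?sqr_ge0 //.
  by rewrite -[leLHS]expr1 ler_weXn2l //; lra.
have -> : drop i = 2 * 4 ^+ k.+3 * z by rewrite /z /lam; field; lra.
have p24 : 4 ^+ k.+3 = 2 ^+ k.+3 * 2 ^+ k.+3 :> R.
  by rewrite -exprMn; congr (_ ^+ _); ring.
rewrite p24; move: key; rewrite ler_pdivlMr //.
move: (2 ^+ k.+3 : R) f20 => p p0 h.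
have : p * (z / 8 * p) <= p * (M * q i) by rewrite ler_pM2l.
lra.
Qed.

(** * Rounding a constant weight on a sparse family *)

Lemma subset_of_card_between (V : finType) (A B : {set V}) (n : nat) :
  A \subset B -> (#|A| <= n <= #|B|)%N ->
  exists X : {set V}, [/\ A \subset X, X \subset B & #|X| = n].
Proof.
move=> AB /andP[An nB].
pose s := take (n - #|A|) (enum (B :\: A)).
have ss : {subset s <= B :\: A} by move=> v /mem_take; rewrite mem_enum.
exists (A :|: [set v in s]); split.
- exact: subsetUl.
- rewrite subUset AB; apply/subsetP => v; rewrite inE => /ss.
  by rewrite inE => /andP[].
- rewrite cardsU (_ : A :&: _ = set0) ?cards0 ?subn0; last first.
    by apply/setP => v; rewrite !inE; apply/andP => -[vA /ss]; rewrite inE vA.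
  rewrite cardsE (card_uniqP _) ?take_uniq ?enum_uniq // size_take_min -cardE.
  by have := cardsID A B; rewrite (setIidPr AB); lia.
Qed.

(** The integrality of the sum is what allows the floating coordinates to be
    rounded without changing it. *)
Lemma round_few_floating (R : realFieldType) (V : finType) (x : {ffun V -> R}) (n : nat) :
  unit_cube x -> \sum_v x v = n%:R ->
  exists X : {set V}, #|X| = n /\
    forall A : {set V}, total A x - #|A :&: X|%:R <= #|A :&: floating x|%:R.
Proof.
move=> xbox xsum.
have count (A B : {set V}) : #|A :&: B|%:R = \sum_(v in A) (v \in B)%:R :> R.
  rewrite -sum1_card natr_sum big_mkcond [RHS]big_mkcond /=.
  by apply: eq_bigr => v _; rewrite inE; case: (v \in A); case: (v \in B).
have count1 (A : {set V}) : #|A|%:R = \sum_v (v \in A)%:R :> R.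
  by rewrite -[A in LHS]setTI count; apply: eq_bigl => v; rewrite inE.
pose O := [set v | x v == 1]; pose P := [set v | 0 < x v].
have OP : O \subset P by apply/subsetP => v; rewrite !inE => /eqP->.
have On : (#|O| <= n <= #|P|)%N.
  rewrite -!(ler_nat R) -xsum !count1; apply/andP; split; apply: ler_sum => v _;
    rewrite inE; have /andP[h0 h1] := xbox v.
    by case: eqP => [->|].
  by case: ltP => // h; apply: le_trans h _.
have [X [OX XP cX]] := subset_of_card_between OP On.
exists X; split=> // A; rewrite /total !count -sumrB; apply: ler_sum => v _.
have /andP[h0 h1] := xbox v; rewrite [v \in floating x]inE.
have [vX|vX] := boolP (v \in X).
  have := subsetP XP v vX; rewrite inE => -> /=.
  by case: ltP => /= [h|h]; lra.
have := contra (subsetP OX v) vX; rewrite inE => xN1.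
have -> /= : x v < 1 by rewrite lt_neqAle xN1.
by rewrite andbT; case: ltP => /= h; lra.
Qed.

(** Induction on the stages.  A set loses nothing while it is small compared with
    the number 16 ^ k of floating coordinates, that is while 4 * q i <= 2 ^ k; this
    is the role of the minimum, which makes the bound independent of the number
    of stages. *)
Lemma rounding (R : realType) (V I : finType) (S : I -> {set V})
    (q : I -> R) (k n : nat) (x : {ffun V -> R}) :
  sparse (fun i => #|S i|) ->
  (forall i, 0 <= q i) -> (forall i, q i ^+ 4 = #|S i|%:R) ->
  unit_cube x -> \sum_v x v = n%:R -> (#|floating x| <= 16 ^ k)%N ->
  exists X : {set V}, #|X| = n /\ forall i, total (S i) x - #|S i :&: X|%:R <=
    32 * walk_constant R * Num.min (2 ^+ k) (4 * q i) * q i.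
Proof.
move=> Ssp q0 q4.
have M1 := walk_constant_ge R; move: (walk_constant R) M1 (@walk_stage R V I S q) => M M1 stage.
have M0 : 0 <= M by lra.
have two0 m : 0 < 2 ^+ m :> R by rewrite exprn_gt0.
have two1 m : 1 <= 2 ^+ m :> R by rewrite exprn_ege1 //; lra.
have base m y : unit_cube y -> \sum_v y v = n%:R -> (#|floating y| <= 256)%N ->
    exists X : {set V}, #|X| = n /\ forall i, total (S i) y - #|S i :&: X|%:R <=
    32 * M * Num.min (2 ^+ m) (4 * q i) * q i.
  move=> ybox ysum yF; have [X [cX hX]] := round_few_floating ybox ysum.
  exists X; split=> // i; apply: le_trans (hX _) _.
  have [S0|Sn] := posnP #|S i|.
    rewrite (_ : _ :&: _ = set0) ?cards0; last first.
      by move/cards0_eq: S0 => ->; rewrite set0I.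
    apply: mulr_ge0 (q0 i); apply: mulr_ge0; first by lra.
    by rewrite le_min (ltW (two0 m)) mulr_ge0.
  have q1 : 1 <= q i.
    by rewrite -(@expr_ge1 _ 4) // q4 ler1n.
  apply: le_trans (_ : 256%:R <= _).
    rewrite ler_nat; apply: leq_trans yF; apply: subset_leq_card; exact: subsetIr.
  have m1 : 1 <= Num.min (2 ^+ m) (4 * q i) by rewrite le_min two1; lra.
  have : 1 * 1 <= Num.min (2 ^+ m) (4 * q i) * q i by apply: ler_pM.
  move=> h; rewrite -mulrA.
  have : 32 * M * 1 <= 32 * M * (Num.min (2 ^+ m) (4 * q i) * q i).
    by rewrite ler_wpM2l //; lra.
  lra.
elim: k x => [|k IH] x xbox xsum xF; first by apply: base => //; apply: leq_trans xF _.
have [k2|] := leqP k 1.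
  apply: base => //; apply: leq_trans xF _.
  by rewrite -[256%N]/(16 ^ 2)%N leq_exp2l.
case: k IH xF => [|[|k]] // IH xF _.
have [y [ybox yF ysum yfix ydrop]] := stage k x Ssp q0 q4 xbox xF.
have [|X [cX hX]] := IH y ybox _ yF; first by rewrite ysum.
exists X; split=> // i.
have -> : total (S i) x - #|S i :&: X|%:R =
  (total (S i) x - total (S i) y) + (total (S i) y - #|S i :&: X|%:R) by ring.
have [small|large] := leqP #|S i| (16 ^ k.+1).
  rewrite yfix // add0r; apply: le_trans (hX i) _.
  rewrite ler_wpM2r // ler_wpM2l ?mulr_ge0 //.
  rewrite le_min ge_min ge_min lexx orbT andbT.
  by rewrite ler_weXn2l //; lra.
have := ydrop i large; have := hX i.
have q2 : 2 ^+ k.+3 <= 4 * q i.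
  have -> : 2 ^+ k.+3 = 4 * 2 ^+ k.+1 :> R by rewrite !exprS; ring.
  rewrite ler_pM2l // -(@ler_pXn2r _ 4) ?nnegrE ?(ltW (two0 _)) // q4.
  have -> : (2 ^+ k.+1) ^+ 4 = (16 ^ k.+1)%:R :> R.
    by rewrite natrX -!exprM mulnC exprM; congr (_ ^+ _); ring.
  by rewrite ler_nat ltnW.
rewrite [Num.min (2 ^+ k.+3) _]min_l //.
have : 32 * M * Num.min (2 ^+ k.+2) (4 * q i) * q i <= 32 * M * 2 ^+ k.+2 * q i.
  rewrite ler_wpM2r // ler_wpM2l ?ge_min ?lexx //; lra.
have -> : 2 ^+ k.+3 = 2 * 2 ^+ k.+2 :> R by rewrite exprS.
lra.
Qed.

Lemma sparse_rounding (R : realType) :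
  exists2 C : R, 0 < C & forall (V I : finType) (S : I -> {set V}) (p : R) (n : nat),
    sparse (fun i => #|S i|) -> 0 <= p <= 1 -> p * #|V|%:R = n%:R ->
    exists X : {set V}, #|X| = n /\
      forall i, p * #|S i|%:R - C * Num.sqrt #|S i|%:R <= #|S i :&: X|%:R.
Proof.
have M1 := walk_constant_ge R.
exists (128 * walk_constant R); first by lra.
move=> V I S p n Ssp p01 pn.
pose x : {ffun V -> R} := [ffun=> p].
pose q i := Num.sqrt (Num.sqrt (#|S i|%:R : R)).
have q0 i : 0 <= q i by rewrite sqrtr_ge0.
have q2 i : q i ^+ 2 = Num.sqrt #|S i|%:R by rewrite sqr_sqrtr ?sqrtr_ge0.
have q4 i : q i ^+ 4 = #|S i|%:R.
  by rewrite (exprM _ 2 2) q2 sqr_sqrtr.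
have totx A : total A x = p * #|A|%:R.
  rewrite /total (eq_bigr (fun=> p)) => [|v _]; last by rewrite ffunE.
  by rewrite sumr_const mulr_natr.
have xbox : unit_cube x by move=> v; rewrite ffunE.
have xsum : \sum_v x v = n%:R.
  by rewrite -pn -cardsT -totx; apply: eq_bigl => v; rewrite inE.
have xF : (#|floating x| <= 16 ^ #|V|)%N.
  by apply: leq_trans (max_card _) (ltnW (ltn_expl _ _)).
have [X [cX hX]] := rounding Ssp q0 q4 xbox xsum xF.
exists X; split=> // i.
have := hX i; rewrite totx -q2.
have : 32 * walk_constant R * Num.min (2 ^+ #|V|) (4 * q i) * q i <=
       32 * walk_constant R * (4 * q i) * q i.
  by rewrite ler_wpM2r // ler_wpM2l ?ge_min ?lexx ?orbT //; lra.
rewrite expr2; lra.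
Qed.

(** * Near-average subtournaments *)

Definition out (V : finType) (e : rel V) (v : V) : {set V} := [set w | e v w].

Lemma sum_outdeg_within (V : finType) (e : rel V) (A : {set V}) :
  tournament e -> ((\sum_(v in A) #|out e v :&: A|) * 2 = #|A| * #|A|.-1)%N.
Proof.
move=> [eirr etot].
have cnt v (r : rel V) : #|[set w | r v w] :&: A| = (\sum_(w in A) r v w)%N.
  rewrite -sum1_card big_mkcond [RHS]big_mkcond /=; apply: eq_bigr => w _.
  by rewrite !inE andbC; case: (w \in A); case: (r v w).
rewrite muln2 -addnn.
have -> : (\sum_(v in A) #|out e v :&: A| = \sum_(v in A) \sum_(w in A) e v w)%N.
  by apply: eq_bigr => v _; rewrite cnt.
rewrite {1}exchange_big /= -big_split /=.
rewrite (eq_bigr (fun=> #|A|.-1)) ?sum_nat_const // => v vA.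
rewrite -big_split /= (bigD1 v) //= eirr add0n (eq_bigr (fun=> 1%N)) => [|w /andP[_ wv]].
  by rewrite sum_nat_const muln1 [in RHS](cardsD1 v) vA /=; apply: eq_card => w; rewrite !inE andbC.
by move: (etot _ _ wv); case: (e v w); case: (e w v).
Qed.

Lemma tournament_sparse (V : finType) (e : rel V) :
  tournament e -> sparse (fun v => #|out e v|).
Proof.
move=> eT D; set A := [set v | _].
have := sum_outdeg_within A eT.
have : (\sum_(v in A) #|out e v :&: A| <= #|A| * D)%N.
  rewrite -sum_nat_const; apply: leq_sum => v; rewrite inE; apply: leq_trans.
  by rewrite subset_leq_card // subsetIl.
by case: #|A| => // a; nia.
Qed.

Lemma outdeg_induced (V : finType) (e : rel V) (X : {set V}) (u : {x | x \in X}) :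
  outdeg (induced e X) u = #|out e (val u) :&: X|.
Proof.
rewrite /outdeg -(card_imset _ val_inj); apply: eq_card => w.
rewrite !inE; apply/imsetP/andP => [[z]|[ew wX]].
  by rewrite inE => ez ->; split=> //; exact: valP z.
by exists (Sub w wX); rewrite ?inE //.
Qed.

(** With [x] the square root of a degree, x^2 / alpha - C x is increasing once
    x >= C alpha, so the vertices of out-degree exactly [s] are the worst ones. *)
Lemma dT_ge (R : realType) (alpha : R) : 1 < alpha ->
  exists (C : R) (s0 : nat), 0 < C /\ forall s, (s0 <= s)%N ->
    s%:R / alpha - (dT alpha s)%:R <= C * Num.sqrt s%:R.
Proof.
move=> a1; have a0 : 0 < alpha by lra.
have [C C0 Crnd] := sparse_rounding R.
pose s0 := (Num.truncn ((C * alpha) ^+ 2)).+1.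
exists (C + 1), s0; split=> [|s s0s]; first by lra.
have sC : C * alpha <= Num.sqrt s%:R.
  have Ca : 0 <= C * alpha by rewrite mulr_ge0 ?ltW.
  rewrite -(@ler_pXn2r _ 2) ?nnegrE ?sqrtr_ge0 // sqr_sqrtr //.
  apply: le_trans (ltW (truncnS_gt _)) _.
  by rewrite ler_nat.
have s1 : 1 <= Num.sqrt s%:R :> R.
  by rewrite -(@ler_pXn2r _ 2) ?nnegrE ?sqrtr_ge0 // sqr_sqrtr // expr1n ler1n; apply: leq_trans s0s.
pose target : R := s%:R / alpha - C * Num.sqrt s%:R.
have t0 : 0 <= target.
  rewrite subr_ge0 ler_pdivlMr // -[leRHS](sqr_sqrtr (ler0n _ _)) expr2 mulrAC ler_wpM2r //.
  by rewrite sqrtr_ge0.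
suff : (Num.truncn target <= dT alpha s)%N.
  rewrite -(ler_nat R) => h; have := truncnS_gt target.
  by rewrite -natr1; rewrite /target in h *; lra.
have [_] := dTP s a1; apply.
move=> n n0 V e eT cV sdeg.
have nV : (n <= #|V|)%N.
  by rewrite cV truncn_ge_nat ?mulr_ge0 ?ler_peMl ?ler0n ?ltW.
have V0 : 0 < #|V|%:R :> R by rewrite ltr0n; apply: leq_trans nV.
pose p : R := n%:R / #|V|%:R.
have p01 : 0 <= p <= 1.
  by rewrite divr_ge0 //= ler_pdivrMr // mul1r ler_nat.
have pn : p * #|V|%:R = n%:R by rewrite divfK // gt_eqF.
have [X [cX hX]] := Crnd V V (out e) p n (tournament_sparse eT) p01 pn.
exists X; split=> //; rewrite leq_min_outdeg; last by rewrite card_sig cX.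
apply/forallP => u; rewrite outdeg_induced -(ler_nat R).
apply: le_trans (_ : target <= _); first by rewrite truncn_le.
apply: le_trans (hX (val u)).
set d := #|out e (val u)|.
have sd : (s <= d)%N.
  move: sdeg; rewrite leq_min_outdeg; last by apply: leq_trans nV.
  by move/forallP/(_ (val u)).
have pa : alpha^-1 <= p.
  rewrite /p ler_pdivlMr // mulrC ler_pdivrMr // mulrC cV.
  by rewrite truncn_le mulr_ge0 // ltW.
apply: le_trans (_ : d%:R / alpha - C * Num.sqrt d%:R <= _); last first.
  by rewrite lerD2r mulrC ler_wpM2r.
have sqsd : Num.sqrt s%:R <= Num.sqrt d%:R :> R by rewrite ler_wsqrtr // ler_nat.
have ds : d%:R = Num.sqrt d%:R ^+ 2 :> R by rewrite sqr_sqrtr.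
have ss : s%:R = Num.sqrt s%:R ^+ 2 :> R by rewrite sqr_sqrtr.
rewrite /target {1}ds {1}ss; move: sqsd sC s1.
move: (Num.sqrt d%:R) (Num.sqrt s%:R) => x y yx yC y1.
rewrite -subr_ge0.
have -> : x ^+ 2 / alpha - C * x - (y ^+ 2 / alpha - C * y) =
  (x - y) * ((x + y) / alpha - C) by ring.
rewrite mulr_ge0 ?subr_ge0 // ler_pdivlMr //; lra.
Qed.

(** * Triples of sum zero meeting a set in two points *)

Definition open_at (G : finZmodType) (Y : {set G}) (x : G) : {set G} :=
  [set y in Y | - x - y \notin Y].

(** Let N t count the [y] in [Y] with [y - t] outside [Y]; N is subadditive.  If
    there are few open pairs, then for most [a] in [Y] the reflection
    y |-> - a - y almost preserves [Y], so N is tiny on differences of such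
    elements.  Conversely, any t for which N t is at most #|Y| / 4 is such a
    difference, by counting.  The set of these t is therefore closed under
    addition, and has about as many elements as [Y]: too many for a proper
    subgroup.  It cannot be the whole group either, because the average of N is
    #|Y| * #|~: Y| / #|G|. *)
Lemma many_open_pairs (G : finZmodType) (L : nat) (Y : {set G}) :
  (1 < L)%N ->
  (forall H : {set G}, 0 \in H -> {in H &, forall x y, x + y \in H} ->
     H = setT \/ (2 * L * #|H| < #|G|)%N) ->
  (#|G| <= L * #|Y|)%N -> (#|G| <= L * #|~: Y|)%N ->
  (#|G| ^ 2 <= 32 * L ^ 3 * \sum_(x in Y) #|open_at Y x|)%N.
Proof.
move=> L1 subgrp YL YcL; rewrite leqNgt; apply/negP => few.
set n := #|Y| in YL.
have q0 : (0 < #|G|)%N by apply/card_gt0P; exists 0.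
have nq : (#|~: Y| + n = #|G|)%N by rewrite addnC cardsC.
have n0 : (0 < n)%N by nia.
pose A := [set a in Y | 8 * L * #|open_at Y a| <= n]%N.
have AY : (4 * #|Y :\: A| < n)%N.
  have h : (#|Y :\: A| * n <= 8 * L * \sum_(x in Y) #|open_at Y x|)%N.
    rewrite -sum_nat_const big_distrr /= [leqRHS](big_setID A) /=.
    apply: leq_trans (leq_addl _ _); apply: leq_sum => x.
    by rewrite !inE => /andP[]; case: (x \in Y); rewrite ?andbF //= -ltnNge => /ltnW.
  have h2 : (#|G| ^ 2 <= L ^ 2 * n ^ 2)%N by rewrite -expnMn leq_exp2r.
  have : (4 * #|Y :\: A| * n < n * n)%N.
    rewrite -(ltn_pmul2l (_ : 0 < L ^ 2)%N) ?expn_gt0; last by rewrite (ltn_trans _ L1).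
    apply: leq_ltn_trans (_ : 32 * L ^ 3 * \sum_(x in Y) #|open_at Y x| < _)%N.
      by rewrite [(L ^ 3)%N]expnS; nia.
    by rewrite mulnn; exact: leq_trans few h2.
  by rewrite ltn_pmul2r.
pose N t := #|[set y in Y | y - t \notin Y]|.
(* If z = - a' - y is in [Y], then y - (a - a') = - a - z. *)
have AAN a a' : a \in A -> a' \in A -> (4 * L * N (a - a')%R <= n)%N.
  rewrite !inE => /andP[_ ba] /andP[_ ba'].
  suff : (N (a - a')%R <= #|open_at Y a| + #|open_at Y a'|)%N by nia.
  pose B := [set y in Y | (- a' - y \in Y) && (y - (a - a') \notin Y)].
  have sub : [set y in Y | y - (a - a') \notin Y] \subset open_at Y a' :|: B.
    by apply/subsetP => y; rewrite !inE => /andP[-> ->] /=; case: (_ \in Y).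
  apply: (leq_trans (subset_leq_card sub)).
  apply: leq_trans (leq_card_setU _ _) _; rewrite addnC leq_add2r.
  have inj : injective (fun y => - a' - y) by move=> y z /addrI /oppr_inj.
  rewrite -(card_imset _ inj); apply: subset_leq_card; apply/subsetP => z.
  case/imsetP => y; rewrite !inE => /and3P[yY y'Y yt] -> {z}; rewrite y'Y /=.
  by move: yt; rewrite !opprD !opprK [in X in X -> _]addrC -addrA.
have ND t u : (N (t + u)%R <= N t + N u)%N.
  pose B := [set y in Y | (y - t \in Y) && (y - (t + u) \notin Y)].
  have sub : [set y in Y | y - (t + u) \notin Y] \subset
      [set y in Y | y - t \notin Y] :|: B.
    by apply/subsetP => y; rewrite !inE => /andP[-> ->] /=; case: (_ \in Y).
  apply: (leq_trans (subset_leq_card sub)).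
  apply: leq_trans (leq_card_setU _ _) _; rewrite leq_add2l.
  have inj : injective (fun y => y - t) by move=> y z /addIr.
  rewrite -(card_imset _ inj); apply: subset_leq_card; apply/subsetP => z.
  case/imsetP => y; rewrite !inE => /and3P[yY y'Y yt] -> {z}; rewrite y'Y /=.
  by move: yt; rewrite opprD addrA.
pose H := [set t | 4 * N t <= n]%N.
(* Some y has both y and y - t among the elements of [A]. *)
have HN t : t \in H -> (4 * L * N t <= n)%N.
  rewrite inE => Nt.
  pose B := [set y in Y | y - t \in A].
  have [y yB] : exists y, y \in B :&: A.
    apply/set0Pn; rewrite -card_gt0.
    have inj : injective (fun y => y - t) by move=> y z /addIr.
    have h1 : (#|Y :\: B| <= N t + #|Y :\: A|)%N.
      have sub : Y :\: B \subset [set y in Y | y - t \notin Y] :|: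
          (fun y => y - t) @^-1: (Y :\: A).
        apply/subsetP => y; rewrite !inE => /andP[]; case: (y \in Y) => //=.
        by case: (y - t \in Y) => //= -> .
      apply: (leq_trans (subset_leq_card sub)).
      apply: leq_trans (leq_card_setU _ _) _; rewrite leq_add2l.
      rewrite on_card_preimset //.
      exists (fun y => y + t) => z _; by rewrite ?addrK ?subrK.
    have AsY : A \subset Y by apply/subsetP => z; rewrite inE => /andP[].
    have BsY : B \subset Y by apply/subsetP => z; rewrite inE => /andP[].
    have h2 : (#|Y| <= #|B :&: A| + #|Y :\: B| + #|Y :\: A|)%N.
      have sub : Y \subset (B :&: A) :|: (Y :\: B) :|: (Y :\: A).
        by apply/subsetP => z zY; rewrite !inE zY /=; case: (z - t \in Y);
          case: (_ <= _)%N; case: (_ <= _)%N.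
      apply: (leq_trans (subset_leq_card sub)).
      apply: leq_trans (leq_card_setU _ _) _; rewrite leq_add2r.
      exact: leq_card_setU.
    by rewrite -/n in h2; lia.
  have /setIP[yB' yA] := yB; move: yB'; rewrite inE => /andP[_ ytA].
  by rewrite -[t](subKr y) AAN.
have N0 : N 0 = 0%N.
  apply/eqP; rewrite cards_eq0; apply/eqP/setP => y.
  by rewrite !inE subr0; case: (y \in Y).
have Hclosed : {in H &, forall t u, t + u \in H}.
  move=> t u /HN tH /HN uH; rewrite inE.
  by apply: leq_trans (_ : 4 * (N t + N u) <= n)%N; [rewrite leq_mul2l ND | nia].
have H0 : 0 \in H by rewrite inE N0.
case: (subgrp H H0 Hclosed) => [HT|]; last first.
  have [a0 a0A] : exists a, a \in A.
    apply/set0Pn; apply: contraTneq AY => ->; rewrite setD0 -/n -leqNgt; lia.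
  have : (#|A| <= #|H|)%N.
    have inj : injective (fun y => a0 - y) by move=> y z /addrI /oppr_inj.
    rewrite -[leqLHS](card_imset _ inj); apply: subset_leq_card.
    apply/subsetP => z. case/imsetP => a aA ->; rewrite inE.
    by apply: leq_trans (AAN _ _ a0A aA); nia.
  have := cardsID A Y; rewrite (setIidPr _); last by apply/subsetP => z; rewrite inE => /andP[].
  rewrite -/n => cA AH; rewrite ltnNge => /negP; apply; apply: leq_trans YL _.
  rewrite -mulnA mulnCA leq_mul2l; apply/orP; right.
  by apply: (@leq_trans (2 * #|A|)); [lia | rewrite leq_mul2l AH].
have sumN : (\sum_t N t = n * #|~: Y|)%N.
  have -> : (\sum_t N t = \sum_t \sum_(y in Y) ((y - t)%R \notin Y))%N.
    apply: eq_bigr => t _; rewrite /N -sum1_card big_mkcond [RHS]big_mkcond /=.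
    by apply: eq_bigr => y _; rewrite !inE; case: (y \in Y); case: (_ \in Y).
  rewrite exchange_big /= -sum_nat_const; apply: eq_bigr => y _.
  have inj : injective (fun t => y - t) by move=> u v /addrI /oppr_inj.
  rewrite (reindex_inj inj) /= -sum1_card [RHS]big_mkcond /=.
  by apply: eq_bigr => t _; rewrite subKr inE; case: (t \in Y).
have : (4 * L * \sum_t N t <= \sum_(t : G) n)%N.
  by rewrite big_distrr; apply: leq_sum => t _; apply: HN; rewrite HT inE.
rewrite sumN sum_nat_const mulnCA [leqRHS]mulnC leq_pmul2l // => h.
have := leq_trans q0 YcL; have := leq_trans h YcL; rewrite -mulnA; lia.
Qed.

Lemma dvdn_card_add_closed (G : finZmodType) (H : {set G}) :
  0 \in H -> {in H &, forall x y, x + y \in H} -> (#|H| %| #|G|)%N.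
Proof.
move=> H0 HD.
have gH : group_set H by apply/group_setP; split=> // x y; exact: HD.
by have := cardSg (subsetT (Group gH)); rewrite cardsT.
Qed.

Lemma doubling_inj (G : finZmodType) : odd #|G| -> injective (fun x : G => x + x).
Proof.
move=> oddG x y /= xy; apply/subr0_eq; set z := x - y.
have z2 : z *+ 2 = 0 by rewrite mulr2n /z addrACA -opprD xy subrr.
have zG : z *+ #|G| = 0.
  by rewrite -FinRing.zmodXgE -cardsT expg_cardG ?inE.
by rewrite -[LHS]mulr1n -[RHS]zG -(odd_double_half #|G|) oddG mulrnDr -mul2n mulrnA z2 mul0rn addr0.
Qed.

(** The index of a proper subgroup divides #|G|, and would divide #|G| - 1 if it
    were at most [m]. *)
Lemma add_closed_small (G : finZmodType) (m : nat) (H : {set G}) :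
  (m`! %| #|G|.-1)%N ->
  0 \in H -> {in H &, forall x y, x + y \in H} ->
  H = setT \/ (m * #|H| < #|G|)%N.
Proof.
move=> mG H0 HD; have /dvdnP[i iE] := dvdn_card_add_closed H0 HD.
have G0 : (0 < #|G|)%N by apply/card_gt0P; exists 0.
have [im|im] := leqP i m; last first.
  right; rewrite iE ltn_pmul2r //; apply/card_gt0P; by exists 0.
left; apply/eqP; rewrite eqEcard subsetT cardsT iE /=.
have i0 : (0 < i)%N by move: G0; rewrite iE; case: i {iE im}.
have : (i %| #|G|.-1)%N by apply: dvdn_trans mG; apply: dvdn_fact; rewrite i0.
have : (i %| #|G|)%N by rewrite iE dvdn_mulr.
rewrite -{1}(prednK G0) -addn1 => iG iG1.
have : (i %| 1)%N by rewrite -(dvdn_addr _ iG1).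
by rewrite dvdn1 => /eqP->; rewrite mul1n.
Qed.

(** * Independent bits: small balls and successive exposure *)

Lemma central_bin_sqr_le (m : nat) : ('C(m.*2, m) ^ 2 * m.*2.+1 <= 16 ^ m)%N.
Proof.
elim: m => // m IH.
have h1 : ((m.*2.+1).+1 * 'C(m.*2.+1, m) = m.+1 * 'C(m.+1.*2, m.+1))%N.
  exact: mul_bin_diag.
have h2 : (m.*2.+1 * 'C(m.*2, m) = m.+1 * 'C(m.*2.+1, m))%N.
  by rewrite (mul_bin_down m.*2.+1 m); congr (_ * _)%N; lia.
move: h1 h2 IH; rewrite [(16 ^ m.+1)%N]expnS.
move: 'C(_, _) 'C(m.*2.+1, m) 'C(m.*2, m) (16 ^ m)%N => c b a p.
rewrite -!mul2n => h1 h2 IH.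
have {h1} cb : c = (2 * b)%N by nia.
rewrite cb -(leq_pmul2l (_ : 0 < m.+1 ^ 2)%N) //.
have -> : (m.+1 ^ 2 * ((2 * b) ^ 2 * (2 * m.+1).+1) =
  4 * (m.+1 * b) ^ 2 * (2 * m + 3))%N by ring.
rewrite -h2.
have -> : (4 * ((2 * m).+1 * a) ^ 2 * (2 * m + 3) =
  a ^ 2 * (2 * m).+1 * (4 * ((2 * m).+1 * (2 * m + 3))))%N by ring.
apply: leq_trans (leq_mul IH (leqnn _)) _.
have -> : (m.+1 ^ 2 * (16 * p) = p * (16 * m.+1 ^ 2))%N by ring.
by rewrite leq_mul2l; apply/orP; right; nia.
Qed.

(** Each entry is compared with a neighbour in the previous row, except in the middle
    of an even row: there the ratio is exactly 2, which is too much, and two rows are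
    treated at a time. *)
Lemma bin_sqr_le (w j : nat) : ('C(w, j) ^ 2 * w.+1 <= 4 ^ w)%N.
Proof.
elim: w j => [|w IH] j; first by rewrite bin0n; case: j.
have arith a b c : (w.+1 * b = a * c)%N -> (w.+2 <= 2 * a)%N ->
    (b ^ 2 * w.+1 <= 4 ^ w)%N -> (c ^ 2 * w.+2 <= 4 ^ w.+1)%N.
  move=> bc wa hb; rewrite [(4 ^ w.+1)%N]expnS -(leq_pmul2r (ltn0Sn w.+1)).
  have h1 : (c ^ 2 * w.+2 * w.+2 <= 4 * (w.+1 * b) ^ 2)%N.
    rewrite bc; have : (w.+2 ^ 2 <= (2 * a) ^ 2)%N by rewrite leq_exp2r.
    by rewrite !expnMn -mulnA mulnn; nia.
  apply: leq_trans h1 _.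
  have -> : (4 * (w.+1 * b) ^ 2 = 4 * (b ^ 2 * w.+1) * w.+1)%N by ring.
  by apply: leq_mul => //; rewrite leq_mul2l hb orbT.
have [jw|wj] := ltnP w.+1 j; first by rewrite bin_small.
have [j1|j1] := ltnP w.+1 j.*2.
  case: j wj j1 => // j wj j1.
  by apply: arith (mul_bin_diag w.+1 j) _ (IH j); lia.
have [j2|j2] := ltnP j.*2 w.+1.
  by apply: arith (mul_bin_down w.+1 j) _ (IH j); lia.
have wE : w.+1 = j.*2 by lia.
by rewrite wE -mul2n expnM mul2n; exact: central_bin_sqr_le.
Qed.

Definition splice (I : finType) (b c : {ffun I -> bool}) (P : {set I}) :
  {ffun I -> bool} := [ffun i => if i \in P then c i else b i].

(** The bits indexed by [tau @: D], once flipped by [eta], form a subset of [D]; the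
    other bits are arbitrary. *)
Lemma card_count_eq (I X : finType) (D : {set X}) (tau : X -> I) (eta : X -> bool)
    (j : nat) :
  {in D &, injective tau} ->
  (#|[set c : {ffun I -> bool} | #|[set y in D | c (tau y) (+) eta y]| == j]| <=
    'C(#|D|, j) * 2 ^ (#|I| - #|D|))%N.
Proof.
move=> tinj.
pose P := tau @: D.
pose phi (c : {ffun I -> bool}) : {set X} * {set I} :=
  ([set y in D | c (tau y) (+) eta y], [set i in ~: P | c i]).
have phi_inj : injective phi.
  move=> c c' [/setP h1 /setP h2]; apply/ffunP => i.
  have [/imsetP[y yD ->]|iP] := boolP (i \in P).
    by have := h1 y; rewrite !inE yD /= => /addIb.
  by have := h2 i; rewrite !inE iP.
rewrite -(card_imset _ phi_inj) -cards_draws.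
have -> : (#|I| - #|D| = #|~: P|)%N by rewrite -(card_in_imset tinj) -(cardsC P) addKn.
rewrite -card_powerset -cardsX; apply: subset_leq_card; apply/subsetP => p.
case/imsetP => c; rewrite inE => cj -> {p}; rewrite !inE /= cj andbT.
apply/andP; split; last by apply/subsetP => i; rewrite !inE => /andP[].
by apply/subsetP => y; rewrite inE => /andP[].
Qed.

Lemma card_window (I X : finType) (D : {set X}) (tau : X -> I)
    (eta : X -> bool) (lo W : nat) :
  {in D &, injective tau} ->
  (#|[set c : {ffun I -> bool} |
      lo <= #|[set y in D | c (tau y) (+) eta y]| < lo + W]| ^ 2 * #|D|.+1 <=
    W ^ 2 * 4 ^ #|I|)%N.
Proof.
move=> tinj; set cnt := fun c : {ffun I -> bool} => #|[set y in D | c (tau y) (+) eta y]|.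
have DI : (#|D| <= #|I|)%N by rewrite -(card_in_imset tinj) max_card.
pose M := (\max_(j < W) 'C(#|D|, lo + j))%N.
have M2 : (M ^ 2 * #|D|.+1 <= 4 ^ #|D|)%N.
  apply: (big_ind (fun k => k ^ 2 * #|D|.+1 <= 4 ^ #|D|)%N) => //.
    by move=> k l; rewrite /maxn; case: ifP.
  by move=> j _; exact: bin_sqr_le.
suff h : (#|[set c | lo <= cnt c < lo + W]%N| <= W * (M * 2 ^ (#|I| - #|D|)))%N.
  apply: leq_trans (_ : (W * (M * 2 ^ (#|I| - #|D|))) ^ 2 * #|D|.+1 <= _)%N.
    by rewrite leq_mul2r leq_exp2r // h.
  have -> : (4 ^ #|I| = 4 ^ #|D| * (2 ^ (#|I| - #|D|)) ^ 2)%N.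
    by rewrite -{1}(subnKC DI) expnD -expnM mulnC [(_ * 2)%N]mulnC expnM mulnC.
  move: (2 ^ (#|I| - #|D|))%N => k.
  have -> : ((W * (M * k)) ^ 2 * #|D|.+1 = W ^ 2 * (M ^ 2 * #|D|.+1 * k ^ 2))%N by ring.
  by rewrite leq_mul2l leq_mul2r M2 !orbT.
apply: leq_trans (_ : \sum_(j < W) #|[set c | cnt c == (lo + j)%N]| <= _)%N.
  have sub : [set c | lo <= cnt c < lo + W]%N \subset
      \bigcup_(j < W) [set c | cnt c == lo + j]%N.
    apply/subsetP => c; rewrite inE => /andP[h1 h2].
    have h3 : (cnt c - lo < W)%N by lia.
    by apply/bigcupP; exists (Ordinal h3) => //; rewrite inE /= subnKC.
  apply: leq_trans (subset_leq_card sub) _.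
  apply: (big_ind2 (fun (A : {set _}) k => #|A| <= k)%N) => //.
    by rewrite cards0.
  move=> A k B l Ak Bl; apply: leq_trans (leq_card_setU _ _) _; exact: leq_add.
rewrite -[W in leqRHS]card_ord -sum_nat_const; apply: leq_sum => j _.
apply: leq_trans (card_count_eq _ _ tinj) _; rewrite leq_mul2r; apply/orP; right.
exact: (leq_bigmax_cond j).
Qed.

(** Conditional probabilities multiply: the vertices are exposed in the order of
    [r], and the event of the last one has conditional probability at most 1 / [m]
    given all the bits outside its own set [P x], which determine the other events.
    Conditioning is expressed by the involution exchanging the [P x]-parts of two
    independent copies of the bits. *)
Lemma card_chain (I X : finType) (r : X -> nat)
    (P : X -> {set I}) (E : X -> {ffun I -> bool} -> bool) (m : nat) (S : {set X}) :
  {in S &, forall x y, x != y -> (r x <= r y)%N ->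
     forall b c, E x (splice b c (P y)) = E x b} ->
  {in S, forall x b, (#|[set c | E x (splice b c (P x))]| * m <= 2 ^ #|I|)%N} ->
  (#|[set b | [forall x in S, E x b]]| * m ^ #|S| <= 2 ^ #|I|)%N.
Proof.
have [n] := ubnP #|S|; elim: n S => // n IH S Sn indep small.
have cardT : #|{ffun I -> bool}| = (2 ^ #|I|)%N by rewrite card_ffun card_bool.
have [->|/set0Pn[x0 x0S]] := eqVneq S set0.
  by rewrite cards0 muln1 -cardT max_card.
case: (arg_maxnP (P := mem S) r x0S) => x /= xS xmax.
pose S' := S :\ x.
have S'S : {subset S' <= S} by move=> y; rewrite inE => /andP[].
have cS : #|S| = #|S'|.+1 by rewrite (cardsD1 x) xS.
pose g b := [forall y in S', E y b].
have {}IH : (#|[set b | g b]| * m ^ #|S'| <= 2 ^ #|I|)%N.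
  apply: IH; first by rewrite -ltnS -cS.
    by move=> y z yS zS; apply: indep; exact: S'S.
  by move=> y yS; apply: small; exact: S'S.
have gE b : [forall y in S, E y b] = g b && E x b.
  apply/forall_inP/andP => [h|[/forall_inP h1 h2] y yS].
    by split; [apply/forall_inP => y /S'S/h | exact: h].
  by have [->//|yx] := eqVneq y x; apply: h1; rewrite in_setD1 yx.
have gsplice b c : g (splice b c (P x)) = g b.
  apply: eq_forallb_in => y; rewrite in_setD1 => /andP[yx yS].
  by apply: indep => //; exact: xmax.
(* [g] is unchanged and the event of [x] is resampled. *)
have swap : (\sum_(p : {ffun I -> bool} * {ffun I -> bool}) (g p.1 && E x p.1) =
    \sum_(p : {ffun I -> bool} * {ffun I -> bool}) (g p.1 && E x (splice p.1 p.2 (P x))))%N.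
  pose f (p : {ffun I -> bool} * {ffun I -> bool}) := (splice p.1 p.2 (P x), splice p.2 p.1 (P x)).
  have ff : involutive f.
    by move=> [b c]; congr (_, _); apply/ffunP => i; rewrite !ffunE /=; case: (i \in P x).
  rewrite (reindex_inj (inv_inj ff)) /=; apply: eq_bigr => -[b c] _ /=.
  by rewrite gsplice.
have p0 : (0 < 2 ^ #|I|)%N by rewrite expn_gt0.
rewrite -(leq_pmul2l p0) cS expnS mulnA mulnA.
have -> : (2 ^ #|I| * #|[set b | [forall y in S, E y b]]| =
    \sum_(p : {ffun I -> bool} * {ffun I -> bool}) (g p.1 && E x p.1))%N.
  rewrite -(pair_bigA _ (fun b _ => nat_of_bool (g b && E x b))) /=.
  transitivity (\sum_(b : {ffun I -> bool}) 2 ^ #|I| * (g b && E x b))%N.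
    rewrite -big_distrr /=; congr (_ * _)%N; rewrite -sum1_card [LHS]big_mkcond.
    by apply: eq_bigr => b _; rewrite inE gE; case: (_ && _).
  by apply: eq_bigr => b _; rewrite sum_nat_const cardT.
rewrite swap -(pair_bigA _ (fun b c => nat_of_bool (g b && E x (splice b c (P x))))) /=.
have gsum : (\sum_b g b = #|[set b | g b]|)%N.
  by rewrite -sum1_card [RHS]big_mkcond; apply: eq_bigr => b _; rewrite inE; case: (g b).
apply: leq_trans (_ : 2 ^ #|I| * #|[set b | g b]| * m ^ #|S'| <= _)%N.
  rewrite leq_mul2r; apply/orP; right.
  rewrite -gsum big_distrl big_distrr /=; apply: leq_sum => b _.
  case gb: (g b) => /=; last by rewrite big1.
  rewrite muln1; apply: leq_trans (small x xS b); rewrite leq_mul2r; apply/orP; right.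
  rewrite -sum1_card [leqRHS]big_mkcond; apply: leq_sum => c _.
  by rewrite inE; case: (E _ _).
by rewrite -mulnA leq_mul2l IH orbT.
Qed.

(** * Tournaments made of cyclic triangles *)

Definition rk (T : finType) (x : T) : nat := enum_rank x.

Lemma rk_inj (T : finType) : injective (@rk T).
Proof. by move=> x y /val_inj /enum_rank_inj. Qed.

(** The orientation of a triple of distinct points for the cyclic order induced by
    [rk], as a bit: exchanging two of the points negates it. *)
Definition cyc (T : finType) (x y z : T) : bool :=
  (rk x < rk y)%N (+) (rk y < rk z)%N (+) (rk z < rk x)%N.

Definition triple (G : finZmodType) (x y : G) : {set G} := [set x; y; - x - y].

(** The bits are indexed by sets so that the three pairs of a triangle share one bit
    without choosing an enumeration of the triangles.  If the third point coincides
    with [x] or [y] there is no triangle, and the pair is oriented along [rk]. *)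
Definition triple_rel (G : finZmodType) (b : {ffun {set G} -> bool}) : rel G :=
  fun x y => (x != y) &&
    if (- x - y == x) || (- x - y == y) then (rk x < rk y)%N
    else cyc x y (- x - y) (+) b (triple x y).

Lemma rk_swap (T : finType) (x y : T) : x != y -> (rk y < rk x)%N = ~~ (rk x < rk y)%N.
Proof. by move=> xy; rewrite -leqNgt [RHS]leq_eqVlt (inj_eq (@rk_inj T)) eq_sym (negPf xy). Qed.

Lemma cyc_swap (T : finType) (x y z : T) : x != y -> y != z -> z != x ->
  cyc y x z = ~~ cyc x y z /\ cyc x z y = ~~ cyc x y z.
Proof.
move=> xy yz zx; rewrite /cyc (rk_swap xy) (rk_swap yz) (rk_swap zx).
by do 3 case: (_ < _)%N.
Qed.

Lemma tripleC (G : finZmodType) (x y : G) : triple y x = triple x y.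
Proof. by rewrite /triple [[set y; x]]setUC addrC. Qed.

Lemma third_third (G : finZmodType) (x y : G) : - x - (- x - y) = y.
Proof. by rewrite opprD !opprK addrA addNr add0r. Qed.

Lemma triple_third (G : finZmodType) (x y : G) : triple x (- x - y) = triple x y.
Proof. by rewrite /triple third_third setUAC. Qed.

Lemma triple_tournament (G : finZmodType) (b : {ffun {set G} -> bool}) :
  tournament (triple_rel b).
Proof.
split=> [x|x y xy]; first by rewrite /triple_rel eqxx.
rewrite /triple_rel xy [y == x]eq_sym xy /= [- y - x]addrC tripleC orbC.
case: ifP => [_|/norP[zy zx]].
  by rewrite (rk_swap xy); case: (_ < _)%N.
have yz : y != - x - y by rewrite eq_sym.
have [-> _] := cyc_swap xy yz zx.
by case: (cyc _ _ _); case: (b _).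
Qed.

(** Apart from at most three exceptional points, the involution y |-> - x - y pairs
    an out-neighbour of [x] with an in-neighbour, for the triangle through them is
    cyclic. *)
Lemma triple_outdeg (G : finZmodType) (b : {ffun {set G} -> bool}) (x : G) :
  odd #|G| -> (#|G| <= 2 * #|out (triple_rel b) x| + 3)%N.
Proof.
move=> oddG.
pose good := [set y | [&& y != x, - x - y != x & - x - y != y]].
have h3 : (#|~: good| <= 3)%N.
  have sub : ~: good \subset x |: ((- x - x) |: [set y | y + y == - x]).
    apply/subsetP => y; rewrite !inE !negb_and !negbK => /or3P[/eqP->|/eqP h|/eqP h].
    - by rewrite eqxx.
    - have -> : y = - x - x by rewrite -[X in _ - X]h third_third.
      by rewrite eqxx orbT.
    - have -> : y + y = - x by rewrite -[X in X + _]h subrK.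
      by rewrite eqxx !orbT.
  apply: leq_trans (subset_leq_card sub) _.
  have h1 : (#|[set y : G | (y + y == - x)%R]| <= 1)%N.
    apply/card_le1P => y; rewrite inE => /eqP yx z; rewrite !inE.
    apply/eqP/eqP => [zx|->//]; apply: (doubling_inj oddG).
    by rewrite /= zx yx.
  by rewrite !cardsU1; exact: leq_add (leq_b1 _) (leq_add (leq_b1 _) h1).
pose o := out (triple_rel b) x.
have inj : injective (fun y => - x - y) by move=> y z /addrI /oppr_inj.
have sub2 : (fun y => - x - y) @: (good :\: o) \subset o.
  apply/subsetP => z /imsetP[y]; rewrite !inE => /andP[yo /and3P[yx zx zy]] -> {z}.
  move: yo; rewrite /triple_rel third_third triple_third.
  rewrite [x == y]eq_sym yx (negPf zx) (negPf zy) /= [x == _]eq_sym zx /=.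
  rewrite [y == x](negPf yx) [y == _]eq_sym (negPf zy) /=.
  have xy : x != y by rewrite eq_sym.
  have yz : y != - x - y by rewrite eq_sym.
  have [_ ->] := cyc_swap xy yz zx.
  by case: (cyc _ _ _); case: (b _).
have := subset_leq_card sub2; rewrite card_imset // => h.
rewrite -(cardsC good) leq_add // -(cardsID o good) mul2n -addnn leq_add //.
by rewrite subset_leq_card // subsetIr.
Qed.

(** The triangles with exactly two vertices in [Y] whose first vertex in [Y] is [x],
    given by their other vertex in [Y]. *)
Definition forward (G : finZmodType) (Y : {set G}) (x : G) : {set G} :=
  [set y in Y | (rk x < rk y)%N && (- x - y \notin Y)].

(** The trace on [Y] of a triangle counted by [forward] determines the triangle, and
    two elements of [Y] that span it are that trace. *)
Lemma triple_forward (G : finZmodType) (Y : {set G}) (x y x' y' : G) :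
  x \in Y -> y \in Y -> x != y -> x' \in Y -> y' \in forward Y x' ->
  triple x y = triple x' y' -> (x = x' /\ y = y') \/ (x = y' /\ y = x').
Proof.
move=> xY yY xy x'Y; rewrite inE => /and3P[y'Y _ z'Y] /setP tE.
have zN w : w \in Y -> w != - x' - y' by apply: contraTneq => ->.
have := tE x; have := tE y; rewrite !inE !eqxx /= orbT.
rewrite (negPf (zN _ xY)) (negPf (zN _ yY)) !orbF.
move=> /esym/orP[] /eqP yE /esym/orP[] /eqP xE; subst; rewrite ?eqxx // in xy *.
- by right.
- by left.
Qed.

Lemma triple_rel_splice (G : finZmodType) (b c : {ffun {set G} -> bool})
    (P : {set {set G}}) (x y : G) :
  (x != y -> triple x y \notin P) ->
  triple_rel (splice b c P) x y = triple_rel b x y.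
Proof.
rewrite /triple_rel; case: eqVneq => //= xy /(_ isT) tP.
by rewrite ffunE (negPf tP).
Qed.

(** Every open pair of distinct points is counted by [forward] at its first point;
    the diagonal contributes at most #|G|, which is negligible as #|G| >= 64 L^3. *)
Lemma many_forward (G : finZmodType) (L : nat) (Y : {set G}) :
  (1 < L)%N ->
  ((2 * L)`! %| #|G|.-1)%N -> (64 * L ^ 3 <= #|G|)%N ->
  (#|G| <= L * #|Y|)%N -> (#|G| <= L * #|~: Y|)%N ->
  (#|G| <= 256 * L ^ 3 *
     #|[set x in Y | #|G| <= 256 * L ^ 3 * #|forward Y x|]|)%N.
Proof.
move=> L1 LG bigG YL YcL.
have := many_open_pairs L1 (fun H => @add_closed_small G (2 * L) H LG) YL YcL.
set M := (L ^ 3)%N in bigG *.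
have openE : (\sum_(x in Y) #|open_at Y x| <= 2 * (\sum_(x in Y) #|forward Y x|) + #|G|)%N.
  pose w x y : nat := (rk x < rk y)%N && (- x - y \notin Y).
  have fE x : #|forward Y x| = (\sum_(y in Y) w x y)%N.
    rewrite -sum1_card big_mkcond [RHS]big_mkcond /=; apply: eq_bigr => y _.
    by rewrite !inE /w; case: (y \in Y) => //=; case: (_ && _).
  rewrite mul2n -addnn.
  have -> : (\sum_(x in Y) #|forward Y x| = \sum_(x in Y) \sum_(y in Y) w x y)%N.
    by apply: eq_bigr => x _.
  rewrite {1}exchange_big /= -big_split /=.
  apply: leq_trans (_ : \sum_(x in Y) (\sum_(y in Y) w y x + \sum_(y in Y) w x y + 1) <= _)%N.
    apply: leq_sum => x xY; rewrite -big_split /= addnC (bigD1 x) //= addnA.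
    have -> : #|open_at Y x| = (\sum_(y in Y) (- x - y \notin Y)%R)%N.
      rewrite -sum1_card big_mkcond [RHS]big_mkcond /=; apply: eq_bigr => y _.
      by rewrite !inE; case: (y \in Y); case: (_ \notin _).
    rewrite (bigD1 x) //= leq_add //; first by case: (_ \notin _); lia.
    apply: leq_sum => y /andP[yY yx].
    rewrite /w [- y - x]addrC (rk_swap (_ : x != y)) 1?eq_sym //.
    by case: (_ < _)%N; case: (_ \in Y).
  rewrite big_split /= leq_add2l sum1_card; exact: max_card.
set F := (\sum_(x in Y) #|forward Y x|)%N in openE * => h.
set g := [set x in Y | _].
have gF : (256 * M * F <= 256 * M * #|g| * #|G| + #|G| * #|G|)%N.
  rewrite /F (big_setID g) /= mulnDr; apply: leq_add.
    rewrite -[leqRHS]mulnA leq_mul2l; apply/orP; right.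
    rewrite -sum_nat_const; apply: leq_trans (_ : \sum_(x in Y :&: g) #|G| <= _)%N.
      by apply: leq_sum => x _; exact: max_card.
    by rewrite !sum_nat_const leq_mul2r subset_leq_card ?orbT // subsetIr.
  apply: leq_trans (_ : \sum_(x in Y :\: g) #|G| <= _)%N.
    rewrite big_distrr /=; apply: leq_sum => x; rewrite /g !inE => /andP[].
    by case: (x \in Y) => //=; rewrite -ltnNge => /ltnW h1 _; exact: h1.
  by rewrite sum_nat_const leq_mul2r max_card orbT.
have q0 : (0 < #|G|)%N by apply/card_gt0P; exists 0.
rewrite -(leq_pmul2r q0).
have arith (o f k q m : nat) : (q * q <= 32 * m * o)%N -> (o <= 2 * f + q)%N ->
    (256 * m * f <= 256 * m * k * q + q * q)%N -> (64 * m <= q)%N ->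
    (q * q <= 256 * m * k * q)%N.
  move=> h1 h2 h3 h4; have h5 : (m * o <= m * (2 * f + q))%N by rewrite leq_mul2l h2 orbT.
  have h6 : (64 * m * q <= q * q)%N by rewrite leq_mul2r h4 orbT.
  nia.
by apply: arith openE gF bigG; rewrite mulnn.
Qed.

(** * A tournament with irregular subtournaments *)

(** The excesses 2 d + u - #|Y| are nonnegative, and since the out-degrees d inside
    [Y] have average (#|Y| - 1) / 2, they add up to at most #|Y| * u. *)
Lemma few_large_outdeg (V : finType) (e : rel V) (Y : {set V}) (u U : nat) :
  tournament e ->
  (forall x, x \in Y -> #|Y| <= 2 * #|out e x :&: Y| + u)%N ->
  (#|[set x in Y | #|Y| + U <= 2 * #|out e x :&: Y| + u]| * U <= #|Y| * u)%N.
Proof.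
move=> eT lower; set n := #|Y| in lower *; set A := [set x in Y | _].
have sumY := sum_outdeg_within Y eT; rewrite -/n in sumY.
have AY : A \subset Y by apply/subsetP => x; rewrite inE => /andP[].
have cA : (#|A| + #|Y :\: A| = n)%N by rewrite /n -(cardsID A Y) (setIidPr AY).
have : (\sum_(x in A) (n + U) + \sum_(x in Y :\: A) n <=
        \sum_(x in Y) (2 * #|out e x :&: Y| + u))%N.
  rewrite [leqRHS](big_setID A) /= (setIidPr AY); apply: leq_add; apply: leq_sum => x.
    by rewrite inE => /andP[].
  by rewrite inE => /andP[_]; exact: lower.
have -> : (\sum_(x in Y) (2 * #|out e x :&: Y| + u) =
    2 * (\sum_(x in Y) #|out e x :&: Y|) + n * u)%N.
  by rewrite big_split big_distrr sum_nat_const.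
rewrite !sum_nat_const mulnC.
have : (n * n.-1 <= n * n)%N by rewrite leq_mul2l leq_pred orbT.
nia.
Qed.

(** The out-degree inside [Y] splits into a part determined by the bits of the other
    vertices and a count of independent bits private to [x]. *)
Lemma outdeg_splice (G : finZmodType) (Y : {set G}) (x : G)
    (b c : {ffun {set G} -> bool}) :
  x \in Y ->
  #|out (triple_rel (splice b c (triple x @: forward Y x))) x :&: Y| =
  (#|out (triple_rel b) x :&: (Y :\: forward Y x)| +
   #|[set y in forward Y x | c (triple x y) (+) cyc x y (- x - y)%R]|)%N.
Proof.
move=> xY; move DE: (forward Y x) => D; set b' := splice _ _ _.
have DY : D \subset Y by apply/subsetP => y; rewrite -DE inE => /andP[].
rewrite -(cardsID D (_ :&: Y)) -setIA (setIidPr DY) addnC -setIDA; congr (_ + _)%N.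
  apply: eq_card => y; rewrite !inE; case yD: (y \in D); rewrite ?andbF //=.
  apply: andb_id2r => yY.
  apply: triple_rel_splice => xy; apply/imsetP => -[y' y'D].
  have y'F : y' \in forward Y x by rewrite DE.
  case/(triple_forward xY yY xy xY y'F) => [[_ yy']|[_ yx]].
    by move: yD; rewrite yy' y'D.
  by move: xy; rewrite yx eqxx.
apply: eq_card => y; rewrite !inE andbC; case yD: (y \in D) => //=.
move: (yD); rewrite -DE inE => /and3P[yY xy zY].
have zx : - x - y != x by apply: contraNneq zY => ->.
have zy : - x - y != y by apply: contraNneq zY => ->.
have xNy : x != y by apply: contraTneq xy => ->; rewrite ltnn.
by rewrite /triple_rel xNy (negPf zx) (negPf zy) /= ffunE imset_f // addbC.
Qed.

Lemma triple_inj (G : finZmodType) (Y : {set G}) (x : G) :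
  x \in Y -> {in forward Y x &, injective (triple x)}.
Proof.
move=> xY y y' yD y'D; move: (yD); rewrite inE => /and3P[yY xy _].
have xNy : x != y by apply: contraTneq xy => ->; rewrite ltnn.
case/(triple_forward xY yY xNy xY y'D) => [[]//|[_ yx]].
by rewrite yx eqxx in xNy.
Qed.

(** A union bound over the pairs (Y, S), where S is a set of at least #|G| / (2 K)
    vertices of [Y] having many private bits and out-degree in the window of width
    U = 2 K u.  Each of the at most 4 ^ #|G| pairs has probability at most
    2 ^ - (8 K #|S|), that is at most 2 ^ - (4 #|G|). *)
Lemma irregular_tournament (L : nat) : (1 < L)%N ->
  exists2 kap, (0 < kap)%N & forall (G : finZmodType) (u : nat), (0 < u)%N ->
    ((2 * L)`! %| #|G|.-1)%N -> (64 * L ^ 3 <= #|G|)%N ->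
    (kap * u ^ 2 <= #|G|)%N ->
  exists e : rel G,
    [/\ tournament e, forall x, (#|G| <= 2 * #|out e x| + 3)%N &
        forall Y : {set G}, (#|G| <= L * #|Y|)%N -> (#|G| <= L * #|~: Y|)%N ->
          exists2 x, x \in Y & (2 * #|out e x :&: Y| + u < #|Y|)%N].
Proof.
move=> L1; pose K := (256 * L ^ 3)%N.
exists (K * (2 * K) ^ 2 * 4 ^ (8 * K))%N.
  have pos j : (0 < j -> 0 < j * (2 * j) ^ 2 * 4 ^ (8 * j))%N.
    by move=> j0; rewrite !muln_gt0 ?expn_gt0 ?muln_gt0 j0.
  by apply: pos; rewrite muln_gt0 expn_gt0 (ltn_trans _ L1).
move=> G u u0 LG bigG.
have -> : (K * (2 * K) ^ 2 * 4 ^ (8 * K) * u ^ 2 =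
  K * (2 * K * u) ^ 2 * 4 ^ (8 * K))%N by rewrite [((2 * K * u) ^ 2)%N]expnMn mulnA [LHS]mulnAC.
move=> KG.
have oddG : odd #|G|.
  have G1 : (0 < #|G|)%N by apply/card_gt0P; exists 0.
  rewrite -(prednK G1) /= -dvdn2; apply: dvdn_trans LG; apply: dvdn_fact.
  by apply/andP; split=> //; apply: leq_trans L1 _; exact: leq_pmull.
suff [b hb] : exists b : {ffun {set G} -> bool}, forall Y : {set G},
    (#|G| <= L * #|Y|)%N -> (#|G| <= L * #|~: Y|)%N ->
    exists2 x, x \in Y & (2 * #|out (triple_rel b) x :&: Y| + u < #|Y|)%N.
  exists (triple_rel b); split=> //; first exact: triple_tournament.
  by move=> x; exact: triple_outdeg.
have K0 : (0 < K)%N by rewrite muln_gt0 /= expn_gt0 (ltn_trans _ L1).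
have q0 : (0 < #|G|)%N by apply/card_gt0P; exists 0.
pose U := (2 * K * u)%N.
have arith (q k g a t : nat) : (q <= k * g -> g <= t + a -> 2 * k * a <= q ->
    q <= 2 * k * t)%N.
  move=> h1 h2 h3; have h4 : (k * g <= k * (t + a))%N by rewrite leq_mul2l h2 orbT.
  by move: h3 h4; rewrite mulnDr -!mulnA; lia.
pose oY b (Y : {set G}) x := #|out (triple_rel b) x :&: Y|.
pose dense (Y : {set G}) := (#|G| <= L * #|Y|)%N && (#|G| <= L * #|~: Y|)%N.
pose ok b := [forall Y : {set G}, dense Y ==> [exists x in Y, 2 * oY b Y x + u < #|Y|]%N].
have window (k c n W : nat) : (n <= 2 * (c + k) + u < n + W ->
    uphalf (n - u) - c <= k < uphalf (n - u) - c + W)%N.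
  by rewrite uphalf_half; have := odd_double_half (n - u); lia.
suff /existsP[b /forallP bok] : [exists b, ok b].
  exists b => Y YL YcL; have := bok Y; rewrite /dense YL YcL => /exists_inP[x xY hx].
  by exists x.
apply: contraT => /existsPn nok.
pose E (Y : {set G}) x b := (#|Y| <= 2 * oY b Y x + u < #|Y| + U)%N.
pose good (Y : {set G}) := [set x in Y | #|G| <= K * #|forward Y x|]%N.
pose valid (p : {set G} * {set G}) :=
  [&& dense p.1, p.2 \subset good p.1 & #|G| <= 2 * K * #|p.2|]%N.
pose bad (p : {set G} * {set G}) := [set b | [forall x in p.2, E p.1 x b]].
(* A failing choice of bits has all the out-degrees inside some [Y] bounded below,
   hence most of them in the window. *)
have covered b : exists2 p, valid p & b \in bad p.
  have := nok b; rewrite negb_forall => /existsP[Y]; rewrite negb_imply => /andP[Yd].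
  rewrite negb_exists => /forallP hY.
  have lower x : x \in Y -> (#|Y| <= 2 * oY b Y x + u)%N.
    by move=> xY; have := hY x; rewrite xY -leqNgt.
  have /andP[YL YcL] := Yd.
  have gY := many_forward L1 LG bigG YL YcL; rewrite -/K -/(good Y) in gY.
  pose A := [set x in Y | #|Y| + U <= 2 * oY b Y x + u]%N.
  have few : (#|A| * U <= #|Y| * u)%N.
    by apply: few_large_outdeg => //; exact: triple_tournament.
  exists (Y, good Y :\: A); rewrite /valid ?inE /= ?Yd ?subsetDl /=.
    have cA : (2 * K * #|A| <= #|G|)%N.
      apply: leq_trans (max_card (mem Y)); rewrite -(leq_pmul2r u0).
      by rewrite (_ : 2 * K * #|A| * u = #|A| * U)%N // /U; ring.
    apply: arith gY _ cA.
    by rewrite -(cardsID A (good Y)) addnC leq_add2l subset_leq_card // subsetIr.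
  apply/forall_inP => x; rewrite !inE => /andP[xA /andP[xY _]].
  by rewrite /E lower //= ltnNge; move: xA; rewrite xY.
(* The window has [U] values, and [x] has so many private bits that each value has
   probability at most 2 ^ - (8 K) / U. *)
have small p : valid p -> (#|bad p| * 2 ^ (4 * #|G|) <= 2 ^ #|{set G}|)%N.
  case: p => Y S /and3P[/= Yd Sgood GS].
  have SY x : x \in S -> x \in Y /\ (#|G| <= K * #|forward Y x|)%N.
    by move/(subsetP Sgood); rewrite inE => /andP[].
  pose P x := triple x @: forward Y x.
  have := @card_chain {set G} G (@rk G) P (E Y) (2 ^ (8 * K)) S.
  set chain := (#|_| * _ <= _)%N => h.
  have {h} : chain.
    apply: h => [x x' xS x'S xx' rxx' b c|x xS b].
      have [xY _] := SY x xS; have [x'Y _] := SY x' x'S.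
      have -> // : E Y x (splice b c (P x')) = E Y x b.
      suff oE : oY (splice b c (P x')) Y x = oY b Y x by rewrite /E oE.
      apply: eq_card => y; rewrite !inE; apply: andb_id2r => yY.
      apply: triple_rel_splice => xy; apply/imsetP => -[y' y'D].
      case/(triple_forward xY yY xy x'Y y'D) => [[xE _]|[xE _]].
        by rewrite xE eqxx in xx'.
      by move: y'D; rewrite -xE inE ltnNge rxx' andbF.
    have [xY xD] := SY x xS.
    pose c0 := #|out (triple_rel b) x :&: (Y :\: forward Y x)|.
    pose lo := (uphalf (#|Y| - u) - c0)%N.
    have sub : [set c | E Y x (splice b c (P x))] \subset
      [set c : {ffun {set G} -> bool} | lo <=
        #|[set y in forward Y x | c (triple x y) (+) cyc x y (- x - y)%R]| < lo + U]%N.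
      apply/subsetP => c; rewrite !inE /E /oY outdeg_splice // -/c0.
      exact: window.
    have := card_window (fun y => cyc x y (- x - y)) lo U (triple_inj xY).
    set w := #|_| => wU.
    apply: leq_trans (_ : w * 2 ^ (8 * K) <= _)%N.
      by rewrite leq_mul2r subset_leq_card ?orbT.
    rewrite -(leq_exp2r _ _ (ltn0Sn 1)).
    have U0 : (0 < U ^ 2)%N by rewrite expn_gt0 muln_gt0 u0 muln_gt0 K0.
    have UD : (U ^ 2 * 4 ^ (8 * K) <= #|forward Y x|.+1)%N.
      apply: ltnW; rewrite ltnS -(leq_pmul2l K0) mulnA.
      exact: leq_trans KG xD.
    rewrite -(leq_pmul2l U0); apply: leq_trans (leq_trans _ wU) _.
      rewrite expnMn mulnCA leq_mul2l -expnM [(_ * 2)%N]mulnC expnM UD orbT //.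
    by rewrite -expnM [(_ * 2)%N]mulnC expnM.
  rewrite /chain; apply: leq_trans; rewrite -expnM leq_mul2l leq_exp2l //.
  by rewrite (_ : 8 * K * #|S| = 4 * (2 * K * #|S|))%N ?leq_mul2l ?GS ?orbT //; ring.
have : (#|{ffun {set G} -> bool}| * 2 ^ (4 * #|G|) <=
        \sum_(p | valid p) 2 ^ #|{set G}|)%N.
  apply: leq_trans (_ : (\sum_(p | valid p) #|bad p|) * 2 ^ (4 * #|G|) <= _)%N.
    rewrite leq_mul2r; apply/orP; right.
    have sub : setT \subset \bigcup_(p | valid p) bad p.
      by apply/subsetP => b _; have [p pv pb] := covered b; apply/bigcupP; exists p.
    rewrite -cardsT; apply: leq_trans (subset_leq_card sub) _.
    apply: (big_ind2 (fun (A : {set _}) k => #|A| <= k)%N) => //.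
      by rewrite cards0.
    move=> A k B l Ak Bl; apply: leq_trans (leq_card_setU _ _) _; exact: leq_add.
  by rewrite big_distrl /=; apply: leq_sum => p; exact: small.
rewrite card_ffun card_bool mulnC sum_nat_const leq_pmul2r ?expn_gt0 //.
have : (#|[pred p | valid p]| <= 2 ^ (2 * #|G|))%N.
  apply: leq_trans (max_card _) _.
  by rewrite card_prod -!cardsT -powersetT card_powerset cardsT -expnD mul2n addnn.
move=> h1 h2; have := leq_trans h2 h1; rewrite leq_exp2l //; lia.
Qed.

(** * Subtournaments below the average *)

(** The extra vertices beat exactly the set [A], so any large [A] gives them a large
    out-degree. *)
Definition extend_rel (G E : finType) (e : rel G) (A : {set G}) : rel (G + E) :=
  fun u v => match u, v with
    | inl x, inl y => e x y
    | inl x, inr _ => x \notin A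
    | inr _, inl y => y \in A
    | inr i, inr j => (rk i < rk j)%N
    end.

Lemma extend_tournament (G E : finType) (e : rel G) (A : {set G}) :
  tournament e -> tournament (@extend_rel G E e A).
Proof.
move=> [eirr etot]; split=> [[x|i]|[x|i] [y|j]] /=; rewrite ?ltnn //.
- by move=> xy; apply: etot; apply: contraNneq xy => ->.
- by case: (_ \in _).
- by case: (_ \in _).
- move=> ij; rewrite (rk_swap (_ : i != j)); last by apply: contraNneq ij => ->.
  by case: (_ < _)%N.
Qed.

Lemma extend_min_outdeg (G E : finType) (e : rel G) (A : {set G}) (s : nat) :
  (0 < #|G|)%N -> (forall x, s <= #|out e x|)%N -> (s <= #|A|)%N ->
  (s <= min_outdeg (@extend_rel G E e A))%N.
Proof.
move=> G0 es As; rewrite leq_min_outdeg; last by rewrite card_sum addn_gt0 G0.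
have inl_inj : injective (@inl G E) by move=> x y [].
apply/forallP => -[x|i]; rewrite /outdeg.
  apply: leq_trans (es x) _; rewrite -(card_imset _ inl_inj).
  by apply: subset_leq_card; apply/subsetP => v /imsetP[y]; rewrite !inE => h ->.
apply: leq_trans As _; rewrite -(card_imset _ inl_inj).
by apply: subset_leq_card; apply/subsetP => v /imsetP[y h ->]; rewrite inE.
Qed.

Lemma card_sum_set (G E : finType) (X : {set G + E}) :
  (#|[set x | inl x \in X]| <= #|X| <= #|[set x | inl x \in X]| + #|E|)%N.
Proof.
have inl_inj : injective (@inl G E) by move=> x y [].
have inr_inj : injective (@inr G E) by move=> x y [].
apply/andP; split.
  rewrite -(card_imset _ inl_inj) subset_leq_card //.
  by apply/subsetP => v /imsetP[y]; rewrite inE => h ->.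
rewrite -(card_imset _ inl_inj) -cardsT -(card_imset _ inr_inj).
apply: leq_trans (leq_card_setU _ _); apply: subset_leq_card.
apply/subsetP => -[x|i] vX; rewrite inE; apply/orP; [left|right].
  by rewrite imset_f // inE.
by rewrite imset_f.
Qed.

Lemma extend_outdeg_le (G E : finType) (e : rel G) (A : {set G}) (X : {set G + E})
    (x : G) :
  (#|out (@extend_rel G E e A) (inl x) :&: X| <=
   #|out e x :&: [set y | inl y \in X]| + #|E|)%N.
Proof.
have /andP[_ h] := card_sum_set (out (@extend_rel G E e A) (inl x) :&: X).
apply: leq_trans h _; rewrite leq_add2r subset_leq_card //.
by apply/subsetP => y; rewrite !inE.
Qed.

(** The [r] extra vertices contribute at most [r] to any out-degree, and a set of [n]
    vertices of the extended tournament has at least [n - r] vertices in [G]. *)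
Lemma forces_le (R : realType) (alpha : R) (G : finType) (e : rel G) (s n u d : nat) :
  tournament e -> (0 < #|G|)%N -> (forall x, s <= #|out e x|)%N -> (0 < n)%N ->
  (#|G| <= Num.truncn (alpha * n%:R))%N ->
  let r := (Num.truncn (alpha * n%:R) - #|G|)%N in
  (forall Y : {set G}, (#|Y| <= n <= #|Y| + r)%N ->
     exists2 x, x \in Y & (2 * #|out e x :&: Y| + u < #|Y|)%N) ->
  forces alpha s d -> (2 * d + u <= n + 2 * r)%N.
Proof.
move=> eT G0 es n0 Gm r irr fd.
have /card_gt0P[x0 _] := G0.
pose e' := @extend_rel G 'I_r e (out e x0).
have cV : #|{: G + 'I_r}| = Num.truncn (alpha * n%:R).
  by rewrite card_sum card_ord subnKC.
have [X [cX Xmin]] := fd n n0 _ e' (@extend_tournament _ _ _ _ eT) cV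
  (@extend_min_outdeg _ _ _ _ _ G0 es (es x0)).
pose Y := [set x : G | inl x \in X].
have Yn := card_sum_set X; rewrite -/Y cX card_ord in Yn.
have [x xY hx] := irr Y Yn.
have xX : inl x \in X by move: xY; rewrite inE.
have : (d <= #|out e x :&: Y| + r)%N.
  move: Xmin; rewrite leq_min_outdeg; last by rewrite card_sig cX.
  move/forallP/(_ (Sub (inl x) xX)); rewrite outdeg_induced SubK => /leq_trans; apply.
  by have := extend_outdeg_le e (out e x0) X x; rewrite card_ord.
move: Yn hx => /andP[h1 _] h2 h3.
have {}h2 := leq_trans h2 h1.
have : (2 * d <= 2 * (#|out e x :&: Y| + r))%N by rewrite leq_mul2l.
by move: h2; move: #|_| => k; clear; lia.
Qed.

Lemma modulus_near (M a : nat) : (0 < M)%N -> (0 < a)%N ->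
  exists k, (a <= (M * k).+1 <= a + M)%N.
Proof.
move=> M0 a0; exists (a.-1 %/ M).+1.
have := ltn_ceil a.-1 M0; have := leq_trunc_div a.-1 M.
by rewrite mulnS mulSn [(_ * M)%N]mulnC; lia.
Qed.

Lemma subset_sizes (R : realType) (alpha q n y L : R) : 1 < alpha ->
  2 * alpha + 2 * alpha / (alpha - 1) <= L ->
  2 * alpha ^+ 2 + 2 * alpha / (alpha - 1) <= q ->
  q / alpha <= n <= q / alpha + 1 -> n - alpha <= y <= n ->
  q <= L * y /\ q <= L * (q - y).
Proof.
move=> a1 Lbig qbig /andP[n_lo n_hi] /andP[y_lo y_hi].
have a0 : 0 < alpha by lra.
have am0 : 0 < alpha - 1 by lra.
have f1 : 0 <= 2 * alpha / (alpha - 1) by rewrite divr_ge0 ?mulr_ge0 ?ltW.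
have f2 : 0 <= 2 * alpha ^+ 2 by rewrite mulr_ge0 ?sqr_ge0.
have h1 : q / (2 * alpha) <= y.
  have h2 : alpha <= q / (2 * alpha) by rewrite ler_pdivlMr ?mulr_gt0 //; lra.
  have h3 : q / alpha = q / (2 * alpha) + q / (2 * alpha) by field; lra.
  lra.
have h1' : q * (alpha - 1) / (2 * alpha) <= q - y.
  have h2 : 1 <= q * (alpha - 1) / (2 * alpha).
    by rewrite ler_pdivlMr ?mulr_gt0 // mul1r -ler_pdivrMr //; lra.
  have h3 : q - q / alpha =
    q * (alpha - 1) / (2 * alpha) + q * (alpha - 1) / (2 * alpha) by field; lra.
  lra.
have q0 : 0 <= q by lra.
split.
  have e1 : 2 * alpha * (q / (2 * alpha)) = q by field; lra.
  rewrite -[leLHS]e1; apply: ler_pM => //; try lra.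
  by rewrite divr_ge0 // mulr_ge0 // ltW.
have e2 : 2 * alpha / (alpha - 1) * (q * (alpha - 1) / (2 * alpha)) = q.
  by field; apply/andP; split; lra.
rewrite -[leLHS]e2; apply: ler_pM => //; last lra.
by rewrite divr_ge0 ?mulr_ge0 // ltW.
Qed.

(** The order of the group is chosen congruent to 1 modulo (2 L)!, which makes all its
    proper subgroups small, and within a constant of 2 s; then [n] is the first
    integer above q / alpha.  The gain is u / 2 with [u] of order
    sqrt s, and all the roundings only cost the constant [C1]. *)
Lemma dT_le (R : realType) (alpha : R) : 1 < alpha ->
  exists (c : R) (s0 : nat), 0 < c /\ forall s, (s0 <= s)%N ->
    c * Num.sqrt s%:R <= s%:R / alpha - (dT alpha s)%:R.
Proof.
move=> a1; have a0 : 0 < alpha by lra.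
have ex_nat (x : R) : exists j : nat, x <= j%:R.
  by exists (Num.truncn x).+1; apply: ltW; exact: truncnS_gt.
have [L [L1 Lbig]] : exists L : nat,
    (1 < L)%N /\ 2 * alpha + 2 * alpha / (alpha - 1) <= L%:R.
  have [j hj] := ex_nat (2 * alpha + 2 * alpha / (alpha - 1)).
  by exists j.+2; split=> //; apply: le_trans hj _; rewrite ler_nat; lia.
have [kap kap0 irregular] := irregular_tournament L1.
have [M [M0 ME]] : exists M, (0 < M)%N /\ M = (2 * L)`! by exists (2 * L)`!; rewrite fact_gt0.
rewrite -ME in irregular.
pose C1 : R := (M%:R + 3) / alpha + 2 * alpha + 2.
pose sk : R := Num.sqrt kap%:R.
have sk0 : 0 < sk by rewrite sqrtr_gt0 ltr0n.
pose T : R := 4 * sk * C1.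
have T0 : 0 <= T.
  have h : 0 <= (M%:R + 3) / alpha by rewrite divr_ge0 ?(ltW a0) // addr_ge0.
  have C1_ge0 : 0 <= C1 by rewrite /C1; lra.
  by apply: mulr_ge0 C1_ge0; apply: mulr_ge0 (ltW sk0).
have [n1 hn1] := ex_nat (2 * alpha ^+ 2 + 2 * alpha / (alpha - 1)).
have [n2 hn2] := ex_nat (T ^+ 2).
exists (4 * sk)^-1, (kap + 64 * L ^ 3 + n1 + n2)%N.
split=> [|s]; first by rewrite invr_gt0 mulr_gt0.
have : exists l, (64 * L ^ 3)%N = l by eexists.
move=> [l lE] s_big; rewrite lE in s_big.
have [s_kap s_l s_n1 s_n2] : [/\ kap <= s, l <= s, n1 <= s & n2 <= s]%N.
  by move: s_big; clear; move=> h; split; lia.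
have s_T : T <= Num.sqrt s%:R.
  rewrite -(@ler_pXn2r _ 2) ?nnegrE ?sqrtr_ge0 // sqr_sqrtr //.
  by apply: le_trans hn2 _; rewrite ler_nat.
(* Out-degrees are at least (q - 3) / 2, so q >= 2 s + 3 is required. *)
have [k] : exists k, (2 * s + 3 <= (M * k).+1 <= 2 * s + 3 + M)%N.
  by apply: modulus_near => //; rewrite addnS.
move qE : (M * k).+1 => q /andP[q_lo q_hi].
have sq : (s <= q)%N by apply: leq_trans q_lo; rewrite mul2n -addnn -addnA leq_addr.
pose u := Num.truncn (Num.sqrt (s%:R : R) / sk).
have u_hi : (kap * u ^ 2 <= s)%N.
  rewrite -(ler_nat R) natrM natrX mulrC -ler_pdivlMr ?ltr0n //.
  apply: le_trans (_ : (Num.sqrt (s%:R : R) / sk) ^+ 2 <= _).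
    by rewrite ler_pXn2r ?nnegrE ?divr_ge0 ?sqrtr_ge0 ?truncn_le ?divr_ge0 ?sqrtr_ge0.
  by rewrite expr_div_n /sk !sqr_sqrtr.
have u_lo : Num.sqrt (s%:R : R) / sk - 1 <= u%:R.
  by have := truncnS_gt (Num.sqrt (s%:R : R) / sk); rewrite -natr1 -/u; lra.
have u0 : (0 < u)%N.
  rewrite truncn_gt0 ler_pdivlMr // mul1r.
  by rewrite ler_wsqrtr // ler_nat.
have cG : #|'I_(M * k).+1| = q by rewrite card_ord.
have [||| e [eT eout eirr]] := irregular 'I_(M * k).+1 u u0.
- by rewrite cG -qE dvdn_mulr.
- by rewrite cG lE; exact: leq_trans sq.
- by rewrite cG; exact: leq_trans sq.
rewrite cG in eout eirr.
have G0 : (0 < #|'I_(M * k).+1|)%N by rewrite card_ord.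
have es x : (s <= #|out e x|)%N.
  by have := leq_trans q_lo (eout x); rewrite leq_add2r leq_mul2l.
pose n := (Num.truncn (q%:R / alpha : R)).+1.
have n_lo : q%:R / alpha <= n%:R :> R by apply: ltW; exact: truncnS_gt.
have n_hi : n%:R <= q%:R / alpha + 1 :> R.
  by rewrite -natr1 lerD2r truncn_le divr_ge0 // ltW.
have an0 : 0 <= alpha * n%:R by rewrite mulr_ge0 // ltW.
have qm : (q <= Num.truncn (alpha * n%:R))%N.
  by rewrite truncn_ge_nat // mulrC -ler_pdivrMr.
have r_hi : (Num.truncn (alpha * n%:R) - q)%:R <= alpha :> R.
  rewrite natrB // lerBlDr; apply: le_trans (_ : alpha * n%:R <= _).
    by rewrite truncn_le.
  by rewrite mulrC -ler_pdivlMr // mulrDl divff ?gt_eqF // addrC.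
have [fd _] := dTP s a1.
have Gm : (#|'I_(M * k).+1| <= Num.truncn (alpha * n%:R))%N by rewrite cG.
have := forces_le (u := u) eT G0 es (ltn0Sn _) Gm _ fd; rewrite cG -/n.
move: (Num.truncn (alpha * n%:R) - q)%N r_hi => r r_hi main.
have {main} : (2 * dT alpha s + u <= n + 2 * r)%N.
  apply: main => Y /andP[Yn nY].
  have cYc : #|~: Y|%:R = q%:R - #|Y|%:R :> R.
    by rewrite -cG -(cardsC Y) natrD addrAC subrr add0r.
  have [] := @subset_sizes R alpha q%:R n%:R #|Y|%:R L%:R a1 Lbig.
  - by apply: le_trans hn1 _; rewrite ler_nat; exact: leq_trans sq.
  - by rewrite n_lo.
  - rewrite ler_nat Yn andbT lerBlDr.
    apply: le_trans (_ : (#|Y| + r)%:R <= _); first by rewrite ler_nat.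
    by rewrite natrD lerD2l.
  by rewrite -cYc -!natrM !ler_nat; exact: eirr.
move=> main.
have h : 2 * (dT alpha s)%:R + u%:R <= n%:R + 2 * r%:R :> R.
  by rewrite -!natrM -!natrD ler_nat.
have {}q_hi : q%:R <= 2 * s%:R + 3 + M%:R :> R.
  by rewrite -natrM -!natrD ler_nat.
have qa : q%:R / alpha <= (2 * s%:R + 3 + M%:R) / alpha :> R.
  by rewrite ler_pM2r ?invr_gt0.
have -> : (4 * sk)^-1 * Num.sqrt s%:R = Num.sqrt s%:R / sk / 4 :> R by field; lra.
have tE : C1 <= Num.sqrt s%:R / sk / 4.
  by rewrite -mulrA -invfM ler_pdivlMr ?mulr_gt0 //; rewrite /T in s_T; lra.
have ia : 0 < alpha^-1 by rewrite invr_gt0.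
have Ma : 0 <= M%:R / alpha by rewrite divr_ge0 // ltW.
rewrite /C1 in tE.
move: (Num.sqrt s%:R / sk) u_lo tE => t u_lo tE.
rewrite !mulrDl in tE qa.
lra.
Qed.

Theorem theorem1p5 (R : realType) (alpha : R) (halpha : 1 < alpha) :
  exists (c C : R) (s0 : nat),
    0 < c /\ 0 < C /\
    forall s : nat, (s0 <= s)%N ->
      c * Num.sqrt s%:R <= s%:R / alpha - (dT alpha s)%:R /\
      s%:R / alpha - (dT alpha s)%:R <= C * Num.sqrt s%:R.
Proof.
have [c [s1 [c0 lower]]] := dT_le halpha.
have [C [s2 [C0 upper]]] := dT_ge halpha.
exists c, C, (maxn s1 s2); split=> //; split=> // s.
by rewrite geq_max => /andP[/lower h1 /upper h2].
Qed.
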